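(* Let $(\Omega,\mathcal{A},\mu)$ be a probability space, where $\mathcal{A}$ is a $\mu$-complete $\sigma$-algebra. Let $T:\Omega\rightarrow \mathbb{R}^n$ be a measurable, $L^1$-bounded set-valued map with compact convex nonempty values, and let $\mathscr{C}\subset \mathcal{A}$ be a sub-$\sigma$-algebra which is $\mu$-coarser than $\mathcal{A}$. Then $$\mathbb{E}(\mathcal{S}_T|\mathscr{C})=\mathbb{E}(\mathcal{S}_{\mathrm{ext}(T)}|\mathscr{C}),\quad \mu\text{-a.e. on } \Omega,$$ that is, these two sets of ($\mu$-a.e. equivalence classes of) functions coincide.
   Context: $\mathcal{A}^+$ denotes the set of $E\in\mathcal{A}$ with $\mu(E)>0$. For a sub-$\sigma$-algebra $\mathscr{C}\subset\mathcal{A}$ and $E\in\mathcal{A}$, $\mathscr{C}_E=\{A\cap E: A\in\mathscr{C}\}$. $\mathscr{C}$ is said to be $\mu$-coarser than $\mathcal{A}$ iff for every $E\in\mathcal{A}^+$ there exists $E_0\in\mathcal{A}$, $E_0\subset E$, such that $\mu(F\Delta E_0)>0$ for all $F\in\mathscr{C}_E$ ($\Delta$ is the symmetric difference). A set-valued map $T:\Omega\to\mathbb{R}^n$ assigns to each $\omega\in\Omega$ a subset $T(\omega)\subset\mathbb{R}^n$. It is measurable iff $\{\omega\in\Omega: T(\omega)\cap O\neq\emptyset\}\in\mathcal{A}$ for every open set $O\subset\mathbb{R}^n$. It is $L^1$-bounded if there is an integrable function $\varphi:\Omega\to\mathbb{R}$ such that $\|x\|\le\varphi(\omega)$ for all $\omega\in\Omega$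 and all $x\in T(\omega)$. For $T$ with convex values, $\mathrm{ext}(T)$ is the set-valued map $\omega\mapsto\{y\in T(\omega): y\text{ is an extreme point of }T(\omega)\}$. For a set-valued map $S$, $\mathcal{S}_S$ denotes the set of its measurable selections, i.e. $\mathcal{A}$-measurable functions $f:\Omega\to\mathbb{R}^n$ with $f(\omega)\in S(\omega)$ for all $\omega\in\Omega$, and $\mathbb{E}(\mathcal{S}_S|\mathscr{C})=\{\mathbb{E}(f|\mathscr{C}): f\in\mathcal{S}_S\}$, where $\mathbb{E}(\cdot|\mathscr{C})$ is the (coordinatewise) conditional expectation given $\mathscr{C}$ under $\mu$. Functions equal $\mu$-a.e. are identified in these sets of conditional expectations. *)

(* Defs.v *)
From HB Require Import structures.
From mathcomp Require Import all_boot all_order all_algebra.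
From mathcomp Require Import all_classical all_reals all_analysis.
Import Order.TTheory GRing.Theory Num.Theory.
Import numFieldNormedType.Exports.

Set Implicit Arguments.
Unset Strict Implicit.
Unset Printing Implicit Defensive.

Local Open Scope classical_set_scope.
Local Open Scope ring_scope.

(* The canonical norm on 'rV[R]_n is the sup norm; this is the Euclidean one. *)
Definition norm2 {R : realType} {n : nat} (x : 'rV[R]_n) : R :=
  Num.sqrt (\sum_(i < n) x ord0 i ^+ 2).

Definition extreme_points {R : realType} {n : nat} (A : set 'rV[R]_n) :
    set 'rV[R]_n :=
  [set x | A x /\ forall (y z : 'rV[R]_n) (t : R), A y -> A z ->
     0 < t -> t < 1 -> x = t *: y + (1 - t) *: z -> y = x /\ z = x].

Section set_valued_maps.
Context {d : measure_display} {Omega : measurableType d} {R : realType}.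
Context {n : nat}.
Implicit Type S : Omega -> set 'rV[R]_n.

Definition measurable_set_valued S : Prop :=
  forall O : set 'rV[R]_n, open O ->
    measurable [set w | S w `&` O !=set0].

Definition L1_bounded (mu : probability Omega R) S : Prop :=
  exists phi : Omega -> R,
    mu.-integrable [set: Omega] (EFin \o phi) /\
    forall w x, S w x -> norm2 x <= phi w.

Definition measurable_selections S : set (Omega -> 'rV[R]_n) :=
  [set f | measurable_fun [set: Omega]
             (f : Omega -> g_sigma_algebraType (@open 'rV[R]_n)) /\
           forall w, S w (f w)].

End set_valued_maps.

Section conditional_expectation.
Context {d : measure_display} {Omega : measurableType d} {R : realType}.
Variables (mu : probability Omega R) (C : set (set Omega)).

(* [g] is a version of the conditional expectation of [f] given [C]; when [C]
   is a sigma-algebra on [Omega], the measurable sets of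
   [g_sigma_algebraType C] are exactly the members of [C]. *)
Definition is_cond_exp (f g : Omega -> R) : Prop :=
  [/\ measurable_fun [set: g_sigma_algebraType C]
        (g : g_sigma_algebraType C -> R),
      mu.-integrable [set: Omega] (EFin \o g) &
      forall A, C A ->
        (\int[mu]_(w in A) (g w)%:E = \int[mu]_(w in A) (f w)%:E)%E].

(* The conditional expectation as a mu-a.e. equivalence class of functions:
   the set of all its versions, taken coordinatewise. *)
Definition cond_exp {n : nat} (f : Omega -> 'rV[R]_n) :
    set (Omega -> 'rV[R]_n) :=
  [set g | forall i : 'I_n,
     is_cond_exp (fun w => f w ord0 i) (fun w => g w ord0 i)].

(* [strace C E] is the trace of [C] on [E], and [`+`] the symmetric
   difference. *)
Definition mu_coarser : Prop :=
  forall E : set Omega, measurable E -> (0 < mu E)%E ->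
    exists E0 : set Omega,
      [/\ measurable E0, E0 `<=` E &
          forall F, strace C E F -> (0 < mu (F `+` E0))%E].

End conditional_expectation.

(* Main.v *)
(* Fix a measurable selection f of T and let K be the set of the measurable
   selections of T with the same conditional expectation as f. For the weighted
   distance \int |x - y|^2 / (1 + phi)^2 dmu, where phi dominates T, the set K is
   complete, and a Borwein-Preiss perturbation of the squared distance to f by a
   series of squared distances is strictly convex and attains its maximum on K,
   at some h. Hence no p with \int |p|^2 / (1 + phi)^2 dmu > 0 is such that both
   h + p and h - p belong to K.
   If h(w) were not extreme on a set of positive measure, a measurable g, not
   a.e. 0, would exist with h + g and h - g selections of T; the mu-coarseness of
   C then gives a nonzero eps with |eps| <= 1 and E(eps * g | C) = 0, and
   p = eps * g is a contradiction. So h is a.e. extreme, and it is corrected on a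
   null set thanks to the completeness of mu. *)
Require Import Defs.
From HB Require Import structures.
From mathcomp Require Import all_boot all_order all_algebra.
From mathcomp Require Import all_classical all_reals all_analysis.
From mathcomp Require Import measurable_realfun ring lra.
Import Order.TTheory GRing.Theory Num.Theory.
Import numFieldNormedType.Exports.
Import HBNNSimple.

Set Implicit Arguments.
Unset Strict Implicit.
Unset Printing Implicit Defensive.

Local Open Scope classical_set_scope.
Local Open Scope ring_scope.

(** * Functions with zero conditional expectation *)

(** A continuous convex functional need not attain its maximum on K: K is complete for the weighted
    distance but in general not compact, and passing to a weak topology would lose upper
    semicontinuity. Hence the perturbation. It has to be quadratic: for squared distances, the
    values at h + p and h - p add up to twice the value at h plus an excess that depends on p only.
    Each subtracted term lowers this excess by its coefficient, and coefficients of total 1/2 leave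
    at least half of it. The weight is there because [phi] is merely integrable, so that |x - y|^2
    need not be; after division by 1 + [phi], coordinate differences are bounded by 2. The finitely
    many coordinates enter through two inductions. A single scalar eps has to annihilate all the
    coordinates of g at once; and g may vanish only where h is extreme, which a lexicographic
    maximization over the coordinates achieves. The latter also turns nonextremality into a
    measurable condition on g. *)

Section conditional_nullity.
Context {d : measure_display} {Omega : measurableType d} {R : realType}.
Variables (mu : probability Omega R) (C : set (set Omega)).
Hypothesis C_sigma_algebra : sigma_algebra [set: Omega] C.
Hypothesis C_sub : C `<=` measurable.
Implicit Types (u v g : Omega -> R) (A B E F : set Omega).

Notation integrable u := (mu.-integrable [set: Omega] (EFin \o u)).
Notation Cmeasurable g := (measurable_fun [set: g_sigma_algebraType C]
  (g : g_sigma_algebraType C -> R)).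

(** The relation E(u | C) = 0, in terms of integrals so that no version has to be chosen. *)
Definition cond_null u : Prop :=
  integrable u /\ forall A, C A -> (\int[mu]_(w in A) (u w)%:E = 0)%E.

Lemma C_measurableE A :
  measurable (A : set (g_sigma_algebraType C)) = C A.
Proof. by rewrite /measurable /= sigma_algebra_id. Qed.

Lemma C_measurable_fun g : Cmeasurable g -> measurable_fun [set: Omega] g.
Proof.
move=> mg _ B mB; apply: C_sub; rewrite -C_measurableE; exact: mg.
Qed.

Lemma C_setI A B : C A -> C B -> C (A `&` B).
Proof. by rewrite -!C_measurableE; exact: measurableI. Qed.

Lemma integrableM u g (M : R) : measurable_fun [set: Omega] g ->
  (forall w, `|g w| <= M) -> integrable u -> integrable (g \* u).
Proof.
move=> mg gM iu.
have mu' : measurable_fun setT u by apply/measurable_EFinP; exact: measurable_int iu.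
apply: (@le_integrable _ _ _ mu setT measurableT _ (fun w => M%:E * (EFin \o u) w)%E).
- by apply/measurable_EFinP; exact: measurable_funM.
- move=> w _ /=; rewrite lee_fin !normrM ler_wpM2r//.
  by rewrite (le_trans (gM w))// ler_norm.
- exact: integrableZl.
Qed.

Lemma cond_nullD u v : cond_null u -> cond_null v -> cond_null (u \+ v).
Proof.
move=> [iu u0] [iv v0]; split.
  by have := integrableD measurableT iu iv; apply: eq_integrable.
move=> A CA; have mA := C_sub CA.
rewrite (eq_integral (fun w => (u w)%:E + (v w)%:E)%E)//.
rewrite integralD//=; [|exact: integrableS iu|exact: integrableS iv].
by rewrite u0// v0// adde0.
Qed.

Lemma cond_nullZ u k : cond_null u -> cond_null (fun w => k * u w).
Proof.
move=> [iu u0]; split.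
  by have := integrableZl measurableT k iu; apply: eq_integrable.
move=> A CA; have mA := C_sub CA.
rewrite (eq_integral (fun w => k%:E * (u w)%:E)%E)//.
rewrite integralZl//=; last exact: integrableS iu.
by rewrite u0// mule0.
Qed.

Lemma cond_null0 : cond_null (cst 0).
Proof.
split; first exact: integrable0.
by move=> A CA; rewrite integral0_eq.
Qed.

Lemma cond_null_sum I (s : seq I) (u : I -> Omega -> R) :
  (forall i, cond_null (u i)) -> cond_null (fun w => \sum_(i <- s) u i w).
Proof.
move=> u0; elim: s => [|i s IH].
  by under eq_fun do rewrite big_nil; exact: cond_null0.
by under eq_fun do rewrite big_cons; exact: cond_nullD.
Qed.

Lemma cond_null_indic u B : C B -> cond_null u ->
  cond_null (fun w => \1_B w * u w).
Proof.
move=> CB [iu u0]; have mB := C_sub CB; split.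
  apply: (@integrableM u (\1_B) 1) => //.
  by move=> w; rewrite indicE; case: (_ \in _); rewrite ?normr1 ?normr0.
move=> A CA.
rewrite -(u0 (A `&` B)); last exact: C_setI.
rewrite [RHS]integral_mkcondr; apply: eq_integral => w _.
by rewrite patchE indicE; case: ifPn; rewrite ?mul1r ?mul0r.
Qed.

(** Pulling a [C]-measurable factor out of a conditional expectation: immediate for indicators of
    members of [C], hence for simple functions, and dominated convergence with bound [M * |u|]
    carries it over to [g]. *)
Lemma cond_nullM_ge0 u g (M : R) : Cmeasurable g -> (forall w, 0 <= g w <= M) ->
  cond_null u -> cond_null (g \* u).
Proof.
move=> mg gM u0; have [iu _] := u0.
have mg' := C_measurable_fun mg.
have ig : integrable (g \* u).
  apply: (@integrableM _ _ M) => // w.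
  by have /andP[g0 ?] := gM w; rewrite ger0_norm.
split=> // A CA; have mA := C_sub CA.
pose T' := g_sigma_algebraType C.
have mEg : measurable_fun [set: T'] (EFin \o g : T' -> \bar R).
  exact/measurable_EFinP.
(* The dyadic approximation is taken over the measurable space of [C], so its level sets [D k] and
   [I] below belong to [C]. *)
pose h n : Omega -> R := approx [set: T'] (EFin \o g : T' -> \bar R) n.
have h_ge0 n w : 0 <= h n w.
  rewrite /h /approx addr_ge0 ?mulr_ge0 ?indicE//.
  by apply: sumr_ge0 => k _; rewrite !mulr_ge0 ?invr_ge0 ?exprn_ge0.
have h_le n w : `|h n w| <= M.
  rewrite ger0_norm//; have /andP[g0 gM'] := gM w.
  rewrite (le_trans _ gM')// -lee_fin.
  by apply: (@le_approx _ T' R setT _ n w) => // x _; have /andP[] := gM x.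
have mh n : Cmeasurable (h n).
  rewrite (_ : h n = nnsfun_approx measurableT mEg n :> (T' -> R)).
    exact: measurable_funP.
  by rewrite nnsfun_approxE.
have h_null n : cond_null (h n \* u).
  rewrite /h /approx.
  set D := dyadic_approx [set: T'] (EFin \o g : T' -> \bar R) n.
  set I := integer_approx [set: T'] (EFin \o g : T' -> \bar R) n.
  rewrite (_ : _ \* _ =
      (fun w => \sum_(k < n * 2 ^ n) (k%:R * 2 ^- n) * (\1_(D k) w * u w)) \+
      (fun w => n%:R * (\1_I w * u w))); last first.
    apply/funext => w /=; rewrite mulrDl mulr_suml mulrA; congr (_ + _).
    by apply: eq_bigr => k _; rewrite mulrA.
  apply: cond_nullD.
    apply: cond_null_sum => k; apply/cond_nullZ/cond_null_indic => //.
    rewrite -C_measurableE /D /dyadic_approx; case: ifPn => // _.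
    rewrite -preimage_comp; apply: mEg => //.
    by apply: measurable_image_EFin; exact: measurable_itv.
  apply/cond_nullZ/cond_null_indic => //.
  rewrite -C_measurableE /I /integer_approx.
  exact: emeasurable_fun_c_infty.
have h_cvg w : h ^~ w @ \oo --> g w.
  apply: (@cvg_approx _ T' R setT (EFin \o g) w) => //.
    by move=> x _; have /andP[] := gM x.
  by rewrite ltry.
have mu' : measurable_fun A u.
  by apply/measurable_funTS/measurable_EFinP; exact: measurable_int iu.
have [] := @dominated_convergence _ _ _ mu A mA
  (fun n => EFin \o (h n \* u)) (EFin \o (g \* u)) (fun w => M%:E * `|(EFin \o u) w|)%E.
- move=> n; apply/measurable_EFinP/measurable_funM => //.
  exact/measurable_funTS/C_measurable_fun.
- apply/measurable_EFinP/measurable_funM => //.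
  exact/measurable_funTS.
- apply/aeW => w _; apply/cvg_EFin; first by apply: nearW.
  by apply: cvgMr_tmp => //; exact: h_cvg.
- apply: integrableZl => //; apply: integrable_abse.
  exact: integrableS iu.
- apply/aeW => w n _ /=; rewrite lee_fin normrM ler_wpM2r//.
move=> _ _.
under [X in X @ _ --> _ -> _]eq_fun do rewrite (proj2 (h_null _) _ CA).
by move=> /(cvg_lim (@ereal_hausdorff R)) <-; exact: lim_cst.
Qed.

Lemma cond_nullM u g (M : R) : Cmeasurable g -> (forall w, `|g w| <= M) ->
  cond_null u -> cond_null (g \* u).
Proof.
move=> mg gM u0.
rewrite (_ : g \* u = (g^\+ \* u) \+ (fun w => -1 * (g^\- \* u) w)); last first.
  by apply/funext => w /=; rewrite -{1}(funrposBneg g) !fctE mulrBl mulN1r.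
apply: cond_nullD.
  apply: (@cond_nullM_ge0 _ _ M) => //; first exact: measurable_funrpos.
  move=> w; rewrite funrpos_ge0 /= (le_trans _ (gM w))//.
  by rewrite /funrpos ge_max normr_ge0 ler_norm.
apply: cond_nullZ.
apply: (@cond_nullM_ge0 _ _ M) => //; first exact: measurable_funrneg.
move=> w; rewrite funrneg_ge0 /= (le_trans _ (gM w))//.
by rewrite /funrneg ge_max normr_ge0 -normrN ler_norm.
Qed.

(** Radon-Nikodym on [C]: [e] is the derivative of the charge of density [u] with respect to [mu],
    both restricted to [C]. *)
Lemma cond_exp_exists u : integrable u ->
  exists e : Omega -> R, Cmeasurable e /\ cond_null (u \- e).
Proof.
move=> iu.
pose T' := g_sigma_algebraType C.
(* Restriction to [C] is encoded as a pushforward along the identity, from [Omega] to the same set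
   equipped with the sigma-algebra of [C]. *)
have mid : measurable_fun [set: Omega] (id : Omega -> T').
  by move=> _ B; rewrite C_measurableE setTI preimage_id; exact: C_sub.
pose X : {mfun Omega >-> T'} := HB.pack (id : Omega -> T')
  (isMeasurableFun.Build _ _ _ _ _ mid).
pose P := distribution mu X : probability T' R.
pose nu_of := pushforward (induced_charge iu) X : {charge set T' -> \bar R}.
pose nu := nu_of mid.
have nuP : nu `<< P.
  apply: (@dominates_pushforward _ _ Omega T' R mu) => //.
  apply/null_content_dominatesP => A mA muA; apply: null_set_integral => //.
  by have := measurable_int _ iu; exact: measurable_funTS.
have fin x := Radon_Nikodym_fin_num x nuP.
have iRN := Radon_Nikodym_integrable nuP.
pose e : Omega -> R := fun w => fine (Radon_Nikodym nu P w).
have RNE : Radon_Nikodym nu P = EFin \o e by apply/funext => w /=; rewrite fineK.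
have me : Cmeasurable e.
  by apply/measurable_EFinP; rewrite -RNE; exact: measurable_int iRN.
exists e; split=> //.
have ie : integrable e.
  apply/integrableP; split.
    exact/measurable_EFinP/C_measurable_fun.
  have /integrableP[_] := iRN; rewrite RNE ge0_integral_distribution//.
  by apply: measurableT_comp => //; exact/measurable_EFinP.
split.
  by have := integrableB measurableT iu ie; apply: eq_integrable.
move=> A CA; have mA := C_sub CA.
rewrite (eq_integral (fun w => (u w)%:E - (e w)%:E)%E)//.
have iuA := integrableS measurableT mA (@subsetT _ A) iu.
rewrite integralB//=; last exact: integrableS ie.
have := @Radon_Nikodym_integral _ _ _ nu P A nuP.
rewrite C_measurableE => /(_ CA).
rewrite RNE /P [X in _ = X -> _](@integral_pushforward _ _ Omega T' R X)//.
- move=> <-; rewrite /nu /nu_of /pushforward /induced_charge /=.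
  by rewrite subee// integrable_fin_num.
- exact/measurable_EFinP.
- by apply: integrableS ie => //; rewrite preimage_id.
- by rewrite C_measurableE.
Qed.



End conditional_nullity.

Lemma measurable_neq0 d (T : measurableType d) (R : realType) (f : T -> R) :
  measurable_fun [set: T] f -> measurable [set x | f x != 0].
Proof.
move=> mf; rewrite (_ : [set _ | _] = ~` (f @^-1` [set 0])).
  by apply: measurableC; rewrite -[X in measurable X]setTI; exact: mf.
by apply/seteqP; split=> x /=; [move/eqP|move=> /eqP].
Qed.

Lemma measurable_funV_gt0 d (T : measurableType d) (R : realType) (f : T -> R) :
  (forall x, 0 < f x) -> measurable_fun [set: T] f ->
  measurable_fun [set: T] (fun x => (f x)^-1).
Proof.
move=> f0 mf; rewrite -[X in measurable_fun _ X]/(GRing.inv \o f).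
apply: (@measurable_comp _ _ _ T R R `]0, +oo[%classic GRing.inv) => //.
- by move=> _ [x _ <-] /=; rewrite in_itv/= f0.
- apply: open_continuous_measurable_fun => // x; rewrite inE /= in_itv/= andbT => x0.
  by apply: inv_continuous; rewrite gt_eqF.
Qed.

(** * Supports relative to [C] and multipliers with zero conditional expectation *)

Section annihilator.
Context {d : measure_display} {Omega : measurableType d} {R : realType}.
Variables (mu : probability Omega R) (C : set (set Omega)).
Hypothesis C_sigma_algebra : sigma_algebra [set: Omega] C.
Hypothesis C_sub : C `<=` measurable.
Implicit Types (u v g : Omega -> R) (A B E F : set Omega).

Notation integrable u := (mu.-integrable [set: Omega] (EFin \o u)).
Notation Cmeasurable g := (measurable_fun [set: g_sigma_algebraType C]
  (g : g_sigma_algebraType C -> R)).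
Notation cond_null := (cond_null mu C).

Lemma cond_null_integral u v A : integrable u -> integrable v ->
  cond_null (u \- v) -> C A ->
  (\int[mu]_(w in A) (u w)%:E = \int[mu]_(w in A) (v w)%:E)%E.
Proof.
move=> iu iv [_ uv0] CA; have mA := C_sub CA.
have iuA := integrableS measurableT mA (@subsetT _ A) iu.
have ivA := integrableS measurableT mA (@subsetT _ A) iv.
have := uv0 _ CA.
rewrite (eq_integral (fun w => (u w)%:E - (v w)%:E)%E)//.
rewrite integralB//= -(fineK (integrable_fin_num mA iuA)).
rewrite -(fineK (integrable_fin_num mA ivA)) -EFinB.
by move=> [] /eqP; rewrite subr_eq0 => /eqP ->.
Qed.

Lemma cond_null_ae0 u : integrable u -> mu [set w | u w != 0] = 0%E ->
  cond_null u.
Proof.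
move=> iu u0; split=> // A CA; have mA := C_sub CA.
have mu' : measurable_fun A (EFin \o u) by exact: measurable_funTS (measurable_int _ iu).
rewrite (@ae_eq_integral _ _ _ mu A (cst 0%E) _ mA mu' (measurable_cst _)) ?integral0//.
exists [set w | u w != 0]; split=> //.
  by apply: measurable_neq0; apply/measurable_EFinP; exact: measurable_int iu.
by move=> w /= /not_implyP[_ /eqP]; rewrite eqe.
Qed.

(** [F] is the set where E(1_E | C) is positive, the smallest member of [C] containing [E] up to
    null sets. The integral of this conditional expectation over a member [A] of [C] is the measure
    of the part of [E] in [A]: off [F] it is at most 0, and for [A] inside [F] it vanishes only if
    [A] is null. *)
Lemma C_support E : measurable E -> exists F, [/\ C F, mu (E `\` F) = 0%E &
  forall A, C A -> A `<=` F -> mu (A `&` E) = 0%E -> mu A = 0%E].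
Proof.
move=> mE.
have iE : integrable \1_E by exact: integrable_indic.
have [e [me ne]] := cond_exp_exists C_sigma_algebra C_sub iE.
have ie : integrable e.
  have := integrableB measurableT iE ne.1.
  by apply: eq_integrable => // w _ /=; rewrite -EFinB; congr EFin; exact: subKr.
have int_e A : C A -> (\int[mu]_(w in A) (e w)%:E = mu (A `&` E))%E.
  move=> CA; rewrite -(cond_null_integral iE ie ne CA) integral_indic//.
    by rewrite setIC.
  exact: C_sub.
pose F := [set w | 0 < e w].
have CF : C F.
  rewrite -(C_measurableE C_sigma_algebra) -[X in measurable X]setTI.
  have -> : F = e @^-1` `]0, +oo[%classic.
    by apply/seteqP; split=> w /=; rewrite in_itv/= andbT.
  exact: me.
exists F; split => //.
  have CFc : C (~` F).
    by move: CF; rewrite -!(C_measurableE C_sigma_algebra); exact: measurableC.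
  rewrite setDE setIC -(int_e _ CFc); apply/eqP; rewrite eq_le; apply/andP; split.
    rewrite -(integral0 mu (~` F)); apply: le_integral.
    - exact: C_sub.
    - by apply: integrableS ie => //; exact: C_sub.
    - exact: integrable0.
    - by move=> w; rewrite inE /= lee_fin leNgt => /negP.
  by rewrite int_e.
move=> A CA AF A0; have mA := C_sub CA.
have := int_e _ CA; rewrite A0 => iA0.
have : (\int[mu]_(w in A) `|(EFin \o e) w| = 0)%E.
  rewrite -iA0; apply: eq_integral => w; rewrite inE => /AF /= ew.
  by rewrite ger0_norm ?ltW.
move=> /(ae_eq_integral_abs mu mA) [].
  exact: measurable_funTS (measurable_int _ ie).
move=> N [mN N0 AN]; apply: (subset_measure0 mA mN _ N0).
by move=> w Aw; apply: AN => /= /(_ Aw) /eqP; rewrite eqe gt_eqF//; exact: AF.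
Qed.

Hypothesis coarser : mu_coarser mu C.

Lemma measure_gt0P A : (0 < mu A)%E <-> mu A <> 0%E.
Proof.
by rewrite measure_gt0; split=> /eqP.
Qed.

(* Split [E] into two pieces that are not separated by [C], and let [e1], [e2] on
   these pieces annihilate the tail of [s]. With [c1], [c2] the conditional
   expectations of [e1 v], [e2 v], the [C]-measurable combination
   [c2 e1 - c1 e2] annihilates [v] too. *)
Lemma coarser_annihilator (s : seq (Omega -> R)) E :
  (forall v, v \in s -> integrable v) -> measurable E -> (0 < mu E)%E ->
  exists eps : Omega -> R, [/\ measurable_fun [set: Omega] eps,
    forall w, `|eps w| <= 1, forall w, ~ E w -> eps w = 0,
    (0 < mu [set w | (eps w != 0)%R])%E &
    forall v, v \in s -> cond_null (eps \* v)].
Proof.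
elim: s E => [|v s IH] E is_ mE E0.
  exists \1_E; split=> //.
  - by move=> w; rewrite indicE; case: (_ \in _); rewrite ?normr1 ?normr0.
  - by move=> w Ew; rewrite indicE memNset.
  - rewrite (_ : [set _ | _] = E)//; apply/seteqP; split=> w /=.
      by rewrite indicE; case: (boolP (w \in E)); rewrite ?inE// eqxx.
    by move=> Ew; rewrite indicE mem_set// oner_neq0.
have iv : integrable v by apply: is_; rewrite mem_head.
have {}is_ u : u \in s -> integrable u by move=> us; apply: is_; rewrite in_cons us orbT.
have [E1 [mE1 E1E cE1]] := coarser mE E0.
have [F1 [CF1 EF1 suppF1]] := C_support mE1.
have mF1 := C_sub CF1.
have mE2 : measurable ((E `\` E1) `&` F1).
  by apply: measurableI => //; exact: measurableD.
(* If this piece were null, the trace of [F1] on [E] would differ from [E1] by a null set, against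
   the choice of [E1]. *)
have E2_gt0 : (0 < mu ((E `\` E1) `&` F1))%E.
  apply/measure_gt0P => E2_0.
  have /measure_gt0P := cE1 (F1 `&` E) (ex_intro2 _ _ F1 CF1 erefl); apply.
  have -> : (F1 `&` E) `+` E1 = ((E `\` E1) `&` F1) `|` (E1 `\` F1).
    rewrite /setY; congr (_ `|` _); first by rewrite -setIDA setIC.
    apply/seteqP; split=> w /= [E1w nw]; split=> //.
      by move=> ?; apply: nw; split=> //; exact: E1E.
    by move=> [].
  by rewrite measureU0//; exact: measurableD.
have [e2 [me2 e2_le1 e2_E2 e2_neq0 null_e2]] := IH _ is_ mE2 E2_gt0.
pose P2 := [set w | e2 w != 0].
have mP2 : measurable P2 by exact: measurable_neq0.
(* With [F2] the intersection of the two supports, every member of [C] of positive measure inside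
   [F2] meets both [E1] and [P2] in positive measure. In particular [E1] keeps some mass in [F2],
   where [e1] is sought. *)
have [F2' [CF2' P2F2' suppF2']] := C_support mP2.
have mF2' := C_sub CF2'.
pose F2 := F2' `&` F1.
have CF2 : C F2 by exact: C_setI.
have mF2 := C_sub CF2.
have F2_gt0 : mu F2 <> 0%E.
  move=> F2_0; move/measure_gt0P : e2_neq0; apply.
  have mU : measurable (P2 `\` F2' `|` F2).
    by apply: measurableU => //; exact: measurableD.
  have U0 : mu (P2 `\` F2' `|` F2) = 0%E.
    by rewrite measureU0//; exact: measurableD.
  apply: (subset_measure0 mP2 mU _ U0) => w P2w.
  have [F2'w|] := pselect (F2' w); [right|by left].
  split=> //; apply: contrapT => F1w; move: P2w => /=.
  by rewrite /P2 /= e2_E2 ?eqxx// => -[].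
have E3_gt0 : (0 < mu (E1 `&` F2))%E.
  apply/measure_gt0P => E3_0; apply: F2_gt0; apply: suppF1 => //; last by rewrite setIC.
  by apply: subIsetr.
have [e1 [me1 e1_le1 e1_E3 e1_neq0 null_e1]] :=
  IH _ is_ (measurableI _ _ mE1 mF2) E3_gt0.
have ie1v : integrable (e1 \* v) by exact: (integrableM _ e1_le1).
have ie2v : integrable (e2 \* v) by exact: (integrableM _ e2_le1).
have [c1 [mc1 null_c1]] := cond_exp_exists C_sigma_algebra C_sub ie1v.
have [c2 [mc2 null_c2]] := cond_exp_exists C_sigma_algebra C_sub ie2v.
pose B := F2 `&` [set w | c1 w != 0].
have CB : C B.
  apply: C_setI => //; rewrite -(C_measurableE C_sigma_algebra).
  exact: measurable_neq0.
have mB := C_sub CB.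
(* If [c1] vanishes a.e. on [F2], then [e1] alone works, since it is supported in [F2]. *)
have [B0|B_neq0] := pselect (mu B = 0%E).
  exists e1; split=> //.
  - by move=> w Ew; apply: e1_E3 => -[/E1E].
  move=> u; rewrite in_cons => /orP[/eqP ->|]; last exact: null_e1.
  rewrite (_ : e1 \* v = (fun w => \1_F2 w * ((e1 \* v) \- c1) w) \+ (\1_F2 \* c1)).
    apply: (cond_nullD C_sub); first exact: (cond_null_indic C_sigma_algebra C_sub).
    have ic1 : integrable c1.
      have := integrableB measurableT ie1v null_c1.1.
      by apply: eq_integrable => // w _ /=; rewrite -EFinB; congr EFin; exact: subKr.
    apply: cond_null_ae0.
      apply: (@integrableM _ _ _ _ _ _ 1) => //.
      by move=> w; rewrite indicE; case: (_ \in _); rewrite ?normr1 ?normr0.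
    apply: (subset_measure0 _ mB _ B0).
      apply: measurable_neq0; apply: measurable_funM => //.
      exact: (C_measurable_fun C_sigma_algebra C_sub mc1).
    move=> w /=; rewrite mulf_eq0 negb_or indicE => /andP[].
    by case: (boolP (w \in F2)); rewrite ?eqxx// inE.
  apply/funext => w /=; rewrite indicE; case: (boolP (w \in F2)) => F2w.
    by rewrite !mul1r subrK.
  rewrite !mul0r addr0 e1_E3 ?mul0r// => -[_].
  by move: F2w; rewrite notin_setE.
(* The common denominator bounds both coefficients by 1 and preserves [a1 * c1 + a2 * c2 = 0], which
   later allows [c1] and [c2] to be subtracted for free. On [B] the coefficient [a2] does not
   vanish. *)
pose a1 w := \1_B w * (c2 w / (1 + `|c1 w| + `|c2 w|)).
pose a2 w := \1_B w * (- c1 w / (1 + `|c1 w| + `|c2 w|)).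
have den_gt0 w : 0 < 1 + `|c1 w| + `|c2 w|.
  by rewrite -addrA ltr_pwDl// addr_ge0.
have mden : Cmeasurable (fun w => (1 + `|c1 w| + `|c2 w|)^-1).
  apply: measurable_funV_gt0 => //; apply: measurable_funD.
    by apply: measurable_funD => //; exact: measurableT_comp.
  exact: measurableT_comp.
have mB' : Cmeasurable (\1_B : Omega -> R).
  by apply: measurable_indic; rewrite C_measurableE.
have ma1 : Cmeasurable a1.
  by do 2 apply: measurable_funM => //.
have ma2 : Cmeasurable a2.
  by do 2 apply: measurable_funM => //; exact: measurable_funN.
have indic_le1 w : `|\1_B w : R| <= 1.
  by rewrite indicE; case: (_ \in _); rewrite ?normr1 ?normr0.
have a1_le1 w : `|a1 w| <= 1.
  rewrite normrM mulr_ile1// normrM normfV (gtr0_norm (den_gt0 w)).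
  by rewrite ler_pdivrMr ?den_gt0// mul1r lerDr addr_ge0.
have a2_le1 w : `|a2 w| <= 1.
  rewrite normrM mulr_ile1// normrM normfV normrN (gtr0_norm (den_gt0 w)).
  by rewrite ler_pdivrMr ?den_gt0// mul1r -addrA addrCA lerDl addr_ge0.
have mul_le1 (x y : R) : `|x| <= 1 -> `|y| <= 1 -> `|x * y| <= 1.
  by move=> x1 y1; rewrite normrM mulr_ile1.
exists (fun w => a1 w * e1 w + a2 w * e2 w); split.
- by apply: measurable_funD; apply: measurable_funM => //;
    exact: (C_measurable_fun C_sigma_algebra C_sub).
(* [e1] lives inside [E1] and [e2] outside it, so at most one term is nonzero and the bound 1
   survives. *)
- move=> w; have [E1w|E1w] := pselect (E1 w).
    by rewrite (e2_E2 w) ?mulr0 ?addr0; [exact: mul_le1|case=> -[]].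
  by rewrite (e1_E3 w) ?mulr0 ?add0r; [exact: mul_le1|case].
- move=> w Ew; rewrite e1_E3 ?e2_E2 ?mulr0 ?addr0//; first by move=> [[]].
  by move=> [/E1E].
(* Where [B] meets [P2] only the term in [e2] remains, and it is nonzero. Were this intersection
   null, so would be [B], by the support property of [F2']. *)
- apply/measure_gt0P => Z0; apply: B_neq0; apply: suppF2' => //.
    by move=> w [[]].
  apply: (subset_measure0 _ _ _ Z0).
  + exact: measurableI.
  + apply: measurable_neq0; apply: measurable_funD; apply: measurable_funM => //.
      exact: (C_measurable_fun C_sigma_algebra C_sub ma1).
    exact: (C_measurable_fun C_sigma_algebra C_sub ma2).
  + move=> w [Bw P2w] /=; rewrite e1_E3 ?mulr0 ?add0r; last first.
      move=> [E1w _]; move: P2w; rewrite /P2 /= e2_E2 ?eqxx//.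
      by move=> [[]].
    apply: mulf_neq0; last exact: P2w.
    rewrite /a2 indicE mem_set// mul1r; apply: mulf_neq0.
      by rewrite oppr_eq0; case: Bw.
    by rewrite invr_eq0 gt_eqF.
- move=> u; rewrite in_cons => /orP[/eqP ->|us]; last first.
    rewrite (_ : _ \* u = (a1 \* (e1 \* u)) \+ (a2 \* (e2 \* u))); last first.
      by apply/funext => w /=; ring.
    apply: (cond_nullD C_sub).
      by apply: (cond_nullM C_sigma_algebra C_sub ma1 a1_le1); exact: null_e1.
    by apply: (cond_nullM C_sigma_algebra C_sub ma2 a2_le1); exact: null_e2.
  rewrite (_ : _ \* v = (a1 \* ((e1 \* v) \- c1)) \+ (a2 \* ((e2 \* v) \- c2))); last first.
    by apply/funext => w /=; rewrite /a1 /a2; ring.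
  apply: (cond_nullD C_sub).
    by apply: (cond_nullM C_sigma_algebra C_sub ma1 a1_le1).
  by apply: (cond_nullM C_sigma_algebra C_sub ma2 a2_le1).
Qed.
End annihilator.

(** * A smooth variational principle *)

(** A point within [e] of the supremum serves, unless [z] has a larger value. Never dropping below
    [G z] makes the values along the iteration of the variational principle nondecreasing. *)
Lemma near_maximizer (R : realType) (X : Type) (K : set X) (G : X -> R) (M e : R) z :
  K z -> (forall y, K y -> G y <= M) -> 0 < e ->
  exists2 z', K z' & G z <= G z' /\ forall y, K y -> G y <= G z' + e.
Proof.
move=> Kz GM e0.
have sG : has_sup (G @` K).
  by split; [exists (G z), z|exists M => _ [y Ky <-]; exact: GM].
have [_ [y Ky <-] Gy] := sup_adherent e0 sG.
have GS x : K x -> G x <= sup (G @` K).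
  by move=> Kx; apply: (ub_le_sup sG.2); exists x.
have [zy|yz] := leP (G z) (G y).
  by exists y => //; split=> // x /GS; lra.
by exists z => //; split=> // x /GS; lra.
Qed.

(* With [F 0 = delta ^~ x0], [z k] an approximate maximizer of [F k] and
   [F k.+1 = F k - c k * delta ^~ (z k)], the sequence [z] converges. As the
   [c k] sum to 1/2, the midpoint identity for [delta] survives in [F k] with [g]
   replaced by [g * A k], [A k >= 1/2]. *)
Lemma quadratic_variational_principle (R : realType) (X : Type) (K : set X)
    (delta : X -> X -> R) (M : R) (x0 : X) : K x0 ->
  (forall x y, K x -> K y -> 0 <= delta x y <= M) ->
  (forall x, K x -> delta x x = 0) ->
  (forall z : nat -> X, (forall k, K (z k)) ->
     (forall k, delta (z k.+1) (z k) <= 16 ^- k) ->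
     exists2 l, K l & forall e, 0 < e -> exists N, forall k, (N <= k)%N ->
       forall y, K y -> `|delta (z k) y - delta l y| <= e) ->
  exists2 z, K z & forall x x' g, K x -> K x' ->
    (forall y, K y -> delta x y + delta x' y = delta z y *+ 2 + g *+ 2) ->
    g <= 0.
Proof.
move=> Kx0 deltaM delta0 complete.
(* [eps k] is [c k] times the wanted increment: near maximality at step [k] will force
   [delta (z k.+1) (z k)] to be at most [eps k / c k], that is [16 ^- k], the rate required by the
   completeness hypothesis. *)
pose c k : R := 2 ^- k.+2.
pose eps k : R := c k * 16 ^- k.
have c_gt0 k : 0 < c k by rewrite invr_gt0 exprn_gt0.
have eps_gt0 k : 0 < eps k by rewrite mulr_gt0// invr_gt0 exprn_gt0.
(* The choice is a total function of a functional, a tolerance and a current point, with the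
   requirements as premises, so that a plain recursion on [nat] can use it. *)
have /choice[pick pickP] (a : (X -> R) * R * X) : exists z',
    K a.2 -> (forall y, K y -> a.1.1 y <= M) -> 0 < a.1.2 ->
    [/\ K z', a.1.1 a.2 <= a.1.1 z' &
        forall y, K y -> a.1.1 y <= a.1.1 z' + a.1.2].
  move: a => [[G e] z] /=.
  have [[Kz GM e0]|H] := pselect [/\ K z, (forall y, K y -> G y <= M) & 0 < e].
    by have [z' Kz' [? ?]] := near_maximizer Kz GM e0; exists z'.
  by exists z => *; exfalso; exact: H.
pose F0 := delta ^~ x0.
pose st := nat_rect (fun=> ((X -> R) * X)%type) (F0, pick (F0, eps 0%N, x0))
  (fun k s => let G := fun x => s.1 x - c k * delta x s.2 in
     (G, pick (G, eps k.+1, s.2))).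
pose F k := (st k).1; pose z k := (st k).2.
have FS k x : F k.+1 x = F k x - c k * delta x (z k) by [].
have zS k : z k.+1 = pick (F k.+1, eps k.+1, z k) by [].
have inv k : [/\ K (z k), (forall y, K y -> F k y <= M) &
    forall y, K y -> F k y <= F k (z k) + eps k].
  elim: k => [|k [Kz FM _]].
    have F0M y : K y -> F0 y <= M by move=> Ky; case/andP: (deltaM _ _ Ky Kx0).
    by have [] := pickP (F0, eps 0%N, x0) Kx0 F0M (eps_gt0 _).
  have FSM y : K y -> F k.+1 y <= M.
    move=> Ky; rewrite FS lerBlDr ler_wpDr ?FM// mulr_ge0 ?(ltW (c_gt0 _))//.
    by case/andP: (deltaM _ _ Ky Kz).
  by have [] := pickP (F k.+1, eps k.+1, z k) Kz FSM (eps_gt0 _); rewrite -zS.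
have Kz k : K (z k) by case: (inv k).
have F_max k y : K y -> F k y <= F k (z k) + eps k by case: (inv k) => _ _; apply.
have F_incr k : F k (z k) <= F k.+1 (z k.+1).
  have [_ FSM _] := inv k.+1.
  have [] := pickP (F k.+1, eps k.+1, z k) (Kz k) FSM (eps_gt0 _).
  by rewrite -zS /= FS delta0// mulr0 subr0.
have [l Kl z_l] : exists2 l, K l & forall e, 0 < e -> exists N, forall k, (N <= k)%N ->
       forall y, K y -> `|delta (z k) y - delta l y| <= e.
  apply: complete => // k.
  rewrite -(ler_pM2l (c_gt0 k)) -/(eps k).
  have := F_incr k; have := F_max k _ (Kz k.+1); rewrite FS; lra.
exists l => // x x' g Kx Kx' mid.
(* [A k] is 1 minus the sum of the [c j] for [j < k]: the fraction of the midpoint excess that is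
   left in [F k]. *)
pose A k : R := 2^-1 + 2 ^- k.+1.
have AS k : A k.+1 = A k - c k.
  by rewrite /A /c !exprS !invfM; lra.
have midF k : F k x + F k x' = F k l *+ 2 + (g * A k) *+ 2.
  elim: k => [|k IH].
    by rewrite /F /= /F0 mid// /A expr1 -mulr2n; lra.
  have := mid _ (Kz k).
  rewrite !FS AS; nra.
(* The constant [2 - A j] is 1 plus the sum of the first [j] coefficients, the total weight of the
   distances in [F j]. The index [j] is separated from [k] for the induction. *)
have lipF k e : (forall y, K y -> `|delta (z k) y - delta l y| <= e) ->
    `|F k (z k) - F k l| <= e *+ 2.
  move=> zle; have lip j : `|F j (z k) - F j l| <= e * (2 - A j).
    elim: j => [|j IH].
      by rewrite /F /= /F0 (le_trans (zle _ Kx0))// /A expr1; lra.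
    rewrite !FS AS.
    have := zle _ (Kz j); have := c_gt0 j.
    by move: IH; rewrite !ler_norml => /andP[? ?] ? /andP[? ?]; nra.
  have e0 : 0 <= e by exact: le_trans (zle _ Kx0).
  rewrite (le_trans (lip k))// -(mulr_natr e 2) ler_wpM2l//.
  by rewrite lerBlDr lerDl /A addr_ge0 ?invr_ge0 ?exprn_ge0.
(* No limit functional is formed; one large [k] suffices. The excess [(g * A k) *+ 2] is at least
   [g], but near maximality at [z k] bounds it by [eps k *+ 2], at most [g / 4], plus twice the gap
   between [F k (z k)] and [F k l], again at most [g / 4]. *)
rewrite leNgt; apply/negP => g0.
have [N zN] := z_l (g / 16) ltac:(lra).
have [m gm] := ltr_add_invr (divr_gt0 g0 (ltr0n R 8)).
pose k := maxn N m.
have := lipF k _ (zN k (leq_maxl _ _)).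
have epsk : eps k <= g / 8.
  rewrite add0r in gm; apply: le_trans (ltW gm).
  have h1 : (2 : R) ^- k <= m.+1%:R^-1.
    rewrite lef_pV2 ?posrE ?exprn_gt0// -natrX ler_nat.
    by rewrite (leq_ltn_trans (leq_maxr N m))// -/k ltn_expl.
  apply: le_trans h1; rewrite /eps /c 2!exprS !invfM.
  have : 0 < (2 : R) ^- k by rewrite invr_gt0 exprn_gt0.
  have : 0 < (16 : R) ^- k by rewrite invr_gt0 exprn_gt0.
  have : (16 : R) ^- k <= 1 by rewrite invf_le1 ?exprn_gt0// exprn_ege1//; lra.
  set u := 16 ^- k; set v := 2 ^- k => *; nra.
have Ak : 2^-1 <= A k by rewrite lerDl invr_ge0 exprn_ge0.
have := midF k; have := F_max k _ Kx; have := F_max k _ Kx'.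
rewrite ler_norml => h1 h2 h3 /andP[h4 h5].
have : g * 2^-1 <= g * A k by rewrite ler_pM2l.
lra.
Qed.

(** * Measurable selections *)

Lemma compact_cluster_seq (R : realType) (V : pseudoMetricType R) (K : set V)
    (y : nat -> V) : compact K -> (forall k, K (y k)) ->
  exists2 l, K l & forall e N, 0 < e -> exists2 k, (N <= k)%N & ball l e (y k).
Proof.
move=> cK Ky.
have yK : (y @ \oo) K by exists 0%N => // k _; exact: Ky.
have [l [Kl cl]] := cK (y @ \oo) _ yK.
exists l => // e N e0.
have [_ [[k Nk <-] lk]] : (y @` [set k | (N <= k)%N]) `&` ball l e !=set0.
  apply: cl; last exact: nbhsx_ballx.
  by exists N => // k Nk; exists k.
by exists k.
Qed.

Lemma closed_approx (R : realType) (V : pseudoMetricType R) (F : set V) x :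
  closed F -> (forall e, 0 < e -> exists2 y, F y & ball x e y) -> F x.
Proof.
move=> cF Fx; apply: cF => B /nbhs_ballP[e e0 eB].
by have [y Fy xy] := Fx e e0; exists y; split=> //; exact: eB.
Qed.

Section measurable_selection.
Context {d : measure_display} {Omega : measurableType d} {R : realType}.
Context {n : nat}.
Notation V := 'rV[R]_n.
Notation Borel_measurable f := (measurable_fun [set: Omega]
  (f : Omega -> g_sigma_algebraType (@open V))).
Implicit Types (f h : Omega -> V) (S G : Omega -> set V).

Definition ratr_row (q : 'rV[rat]_n) : V := map_mx ratr q.

Lemma ratr_row_dense (x : V) e : 0 < e -> exists q, ball x e (ratr_row q).
Proof.
move=> e0.
have /choice[q xq] (i : 'I_n) : exists q : rat, ball (x ord0 i) e (ratr q : R).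
  have /rat_in_itvoo[q] : x ord0 i < x ord0 i + e by rewrite ltrDl.
  rewrite in_itv /= => /andP[? ?]; exists q.
  by rewrite /ball /= ltr_distlC; lra.
exists (\row_i q i); split=> // i j; rewrite !mxE (ord1 i); exact: xq.
Qed.

Lemma Borel_measurableP f :
  Borel_measurable f <-> forall i, measurable_fun [set: Omega] (fun w => f w ord0 i).
Proof.
split=> [mf i|mf].
  apply: (measurability _ (RGenOpens.measurableE R)) => _ [_ [a [b ->] <-]].
  rewrite setTI.
  have : Borel_measurable f by [].
  move=> /(_ measurableT ((fun x : V => x ord0 i) @^-1` `]a, b[%classic)).
  rewrite setTI; apply; apply: sub_sigma_algebra.
  apply: open_comp; last exact: interval_open.
  by move=> x _; exact: coord_continuous.
have mb (q : V) (e : R) : measurable (f @^-1` ball q e).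
  (* A ball of row vectors carries the condition [0 < e], so it is empty for [e <= 0] even when [n]
     is 0. *)
  have [e0|e0] := ltP 0 e; last first.
    rewrite (_ : _ @^-1` _ = set0)//; apply/seteqP; split=> // w [/=].
    by rewrite ltNge e0.
  rewrite (_ : _ @^-1` _ =
      \bigcap_(i in [set: 'I_n]) [set w | `|q ord0 i - f w ord0 i| < e]).
    apply: fin_bigcap_measurable => // i _.
    rewrite -[X in measurable X]setTI.
    have mqf : measurable_fun [set: Omega] (fun w => `|q ord0 i - f w ord0 i|).
      by apply: measurableT_comp => //; exact: measurable_funB.
    have := mqf measurableT _ (measurable_itv `]-oo, e[).
    by rewrite set_itvE.
  apply/seteqP; split=> w.
    by move=> [_ qf] i _ /=; exact: qf.
  by move=> qf; split=> // i j; rewrite (ord1 i); exact: qf.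
apply: (@measurability _ _ Omega (g_sigma_algebraType (@open V)) setT f
  (@open V)) => // _ [B oB <-].
rewrite setTI.
rewrite (_ : _ @^-1` B = \bigcup_(p in [set: 'rV[rat]_n * nat])
   (if `[< ball (ratr_row p.1) p.2.+1%:R^-1 `<=` B >]
    then f @^-1` ball (ratr_row p.1) p.2.+1%:R^-1 else set0)).
  by apply: countable_bigcupT_measurable => // p; case: ifPn.
apply/seteqP; split=> [w Ofw|w [p _]]; last first.
  by case: ifPn => // /asboolP pO; exact: pO.
have /nbhs_ballP[e /= e0 eO] : nbhs (f w) B by exact: open_nbhs_nbhs.
have [m] := ltr_add_invr (divr_gt0 e0 (ltr0n R 2)); rewrite add0r => me.
have m0 : 0 < m.+1%:R^-1 :> R by [].
have [q fq] := ratr_row_dense (f w) m0.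
exists (q, m) => //=; rewrite ifT; first exact: ball_sym.
apply/asboolP => x qx; apply: eO.
by apply: le_ball (ball_triangle fq qx); rewrite [leRHS]splitr lerD ?ltW.
Qed.

Lemma rV_ballP (x y : V) e :
  ball x e y <-> 0 < e /\ forall i, `|x ord0 i - y ord0 i| < e.
Proof.
split=> [[e0 xy]|[e0 xy]]; split=> // i; first exact: xy.
by move=> j; rewrite (ord1 i); exact: xy.
Qed.

(** Tested on closed sets, unlike [measurable_set_valued]: maximizing a coordinate brings in closed
    half-spaces, intersected with the test set. *)
Definition closed_measurable S :=
  forall F : set V, closed F -> measurable [set w | S w `&` F !=set0].

(** A direction in [F] is detected at each scale [r k] by rational approximations of h(w) and of the
    direction, a countable condition. Conversely, the points of [S w] found at all scales have a
    cluster point by compactness, and closedness of [F] and [S w] makes it yield an exact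
    direction. *)
Lemma closed_measurable_symmetric S h : (forall w, compact (S w)) ->
  measurable_set_valued S -> Borel_measurable h ->
  closed_measurable (fun w => [set x | S w (h w + x) /\ S w (h w - x)]).
Proof.
move=> cS mS mh F cF.
pose r k : R := k.+1%:R^-1.
have r0 k : 0 < r k by rewrite /r invr_gt0.
pose Q k (pq : 'rV[rat]_n * 'rV[rat]_n) :=
  let p := ratr_row pq.1 in let q := ratr_row pq.2 in
  if `[< F `&` ball q (r k) !=set0 >] then
    h @^-1` ball p (r k) `&`
    ([set w | S w `&` ball (p + q) (r k *+ 2) !=set0] `&`
     [set w | S w `&` ball (p - q) (r k *+ 2) !=set0])
  else set0.
rewrite (_ : [set w | _] = \bigcap_k \bigcup_pq Q k pq).
  apply: bigcapT_measurable => k; apply: countable_bigcupT_measurable => // pq.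
  rewrite /Q; case: ifPn => // _; apply: measurableI.
    rewrite -[X in measurable X]setTI; apply: mh => //.
    by apply: sub_sigma_algebra; exact: ball_open.
  by apply: measurableI; apply: mS; exact: ball_open.
apply/seteqP; split=> w.
  move=> [x [[Sx Sx'] Fx]] k _.
  have [p hp] := ratr_row_dense (h w) (r0 k).
  have [q xq] := ratr_row_dense x (r0 k).
  exists (p, q) => //; rewrite /Q ifT; last first.
    by apply/asboolP; exists x; split=> //; exact: ball_sym.
  move: (hp) (xq) => /rV_ballP[_ hp'] /rV_ballP[_ xq'].
  rewrite /=; split; first exact: ball_sym.
  split.
    exists (h w + x); split=> //; apply/rV_ballP; split=> [|i]; first by rewrite mulrn_wgt0.
    by have := hp' i; have := xq' i; rewrite !mxE !ltr_distl => /andP[? ?] /andP[? ?]; lra.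
  exists (h w - x); split=> //; apply/rV_ballP; split=> [|i]; first by rewrite mulrn_wgt0.
  by have := hp' i; have := xq' i; rewrite !mxE !ltr_distl => /andP[? ?] /andP[? ?]; lra.
move=> Qw.
have /choice[a Ha] k : exists a : V * V * (V * V * V),
    [/\ ball a.1.1 (r k) (h w), F a.2.1.1 /\ ball a.1.2 (r k) a.2.1.1,
        S w a.2.1.2 /\ ball (a.1.1 + a.1.2) (r k *+ 2) a.2.1.2 &
        S w a.2.2 /\ ball (a.1.1 - a.1.2) (r k *+ 2) a.2.2].
  have [[p q] _] := Qw k Logic.I; rewrite /Q; case: ifPn => // /asboolP[x [Fx qx]].
  move=> [hp [[y [Sy py]] [z [Sz pz]]]].
  by exists (ratr_row p, ratr_row q, (x, y, z)).
have Sy k : S w (a k).2.1.2 by have [_ _ []] := Ha k.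
have [l Sl yl] := compact_cluster_seq (cS w) Sy.
have est e : 0 < e -> exists k, F (a k).2.1.1 /\ ball (l - h w) e (a k).2.1.1 /\
    S w (a k).2.2 /\ ball (h w - (l - h w)) e (a k).2.2.
  (* The costlier estimate is that of [h w - (l - h w)]: [e / 2] from the cluster point plus six
     radii [r k]. *)
  move=> e0; have e12 : 0 < e / 12 by rewrite divr_gt0.
  have [N] := ltr_add_invr e12; rewrite add0r => Ne.
  have e20 : 0 < e / 2 by rewrite divr_gt0.
  have [k Nk /rV_ballP[_ lk]] := yl _ N e20.
  have re : r k < e / 12.
    by apply: le_lt_trans Ne; rewrite lef_pV2 ?posrE// ler_nat.
  have [/rV_ballP[_ b1] [Fx /rV_ballP[_ b2]] [_ /rV_ballP[_ b3]]
    [Sz /rV_ballP[_ b4]]] := Ha k.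
  exists k; split=> //; split; last split=> //; apply/rV_ballP; split=> // i.
    have := lk i; have := b1 i; have := b2 i; have := b3 i.
    rewrite !mxE !ltr_distl => /andP[? ?] /andP[? ?] /andP[? ?] /andP[? ?]; lra.
  have := lk i; have := b1 i; have := b4 i; have := b3 i.
  rewrite !mxE !ltr_distl => /andP[? ?] /andP[? ?] /andP[? ?] /andP[? ?]; lra.
exists (l - h w); split; first split.
- by rewrite addrC subrK.
- apply: closed_approx; first exact: (compact_closed (@norm_hausdorff _ V) (cS w)).
  by move=> e e0; have [k [_ [_ [? ?]]]] := est e e0; exists (a k).2.2.
- apply: closed_approx cF _ => e e0.
  by have [k [? [? _]]] := est e e0; exists (a k).2.1.1.
Qed.

Definition coord_maximizers (i : 'I_n) (A : set V) : set V :=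
  [set x | A x /\ forall y, A y -> y ord0 i <= x ord0 i].

Lemma compact_coord_maximizers i A : compact A -> compact (coord_maximizers i A).
Proof.
move=> cA; apply: (subclosed_compact _ cA); last by move=> x [].
move=> x clx; split.
  apply: (compact_closed (@norm_hausdorff _ V) cA).
  by apply: closure_subset clx => y [].
move=> y Ay; apply/ler_addgt0Pr => e e0.
have [z [[_ /(_ _ Ay) yz]]] := clx _ (nbhsx_ballx x e e0).
by move=> /rV_ballP[_ /(_ i)]; rewrite ltr_distl => /andP[? ?]; lra.
Qed.

Lemma coord_maximizers_nonempty i A : compact A -> A !=set0 ->
  coord_maximizers i A !=set0.
Proof.
move=> cA A0.
have [x xA xmax] := @EVT_max_rV R n (fun x => x ord0 i) A A0 cA
  (continuous_subspaceT (@coord_continuous R 1 n ord0 i)).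
by exists x; split=> [|y Ay]; [exact/set_mem|apply: xmax; exact/mem_set].
Qed.

(** A maximizer lies in [F] iff every rational level reached by coordinate [i] on [S w] is also
    reached on the part of [S w] in [F]. For the converse, levels just below the maximum yield
    points of [F] with a cluster point attaining it. *)
Lemma closed_measurable_coord_maximizers i S : (forall w, compact (S w)) ->
  (forall w, S w !=set0) -> closed_measurable S ->
  closed_measurable (fun w => coord_maximizers i (S w)).
Proof.
move=> cS S0 mS F cF.
pose H (q : rat) := [set x : V | ratr q <= x ord0 i].
have cH q : closed (H q).
  rewrite (_ : H q = (fun x : V => x ord0 i) @^-1` `[ratr q, +oo[%classic).
    apply: closed_comp; last exact: interval_closed.
    by move=> x _; exact: coord_continuous.
  by apply/seteqP; split=> x /=; rewrite in_itv/= andbT.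
rewrite (_ : [set w | _] = \bigcap_(q : rat)
    (~` [set w | S w `&` H q !=set0] `|` [set w | S w `&` (F `&` H q) !=set0])).
  rewrite -[X in measurable X]setCK setC_bigcap; apply: measurableC.
  apply: bigcupT_measurable_rat => q; apply: measurableC.
  by apply: measurableU; [apply: measurableC|]; apply: mS => //; exact: closedI.
apply/seteqP; split=> w.
  move=> [x [[Sx xmax] Fx]] q _ /=.
  have [[y [Sy Hy]]|] := pselect (S w `&` H q !=set0); last by left.
  by right; exists x; split=> //; split=> //; rewrite /H /=; exact: le_trans (xmax _ Sy).
move=> HF; have [m [Sm mmax]] := coord_maximizers_nonempty i (cS w) (S0 w).
have /choice[y Hy] (k : nat) : exists y,
    [/\ S w y, F y & m ord0 i - k.+1%:R^-1 < y ord0 i].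
  have /rat_in_itvoo[q] : m ord0 i - k.+1%:R^-1 < m ord0 i by rewrite ltrBlDr ltrDl.
  rewrite in_itv/= => /andP[mq qm].
  have [|[y [Sy [Fy Hy]]]] := HF q Logic.I.
    by case; exists m; split=> //; exact: ltW.
  by exists y; split=> //; exact: lt_le_trans mq _.
have Sy k : S w (y k) by have [] := Hy k.
have [l Sl yl] := compact_cluster_seq (cS w) Sy.
exists l; split; last first.
  apply: closed_approx cF _ => e e0; have [k _ lk] := yl e 0%N e0.
  by exists (y k) => //; have [] := Hy k.
split=> // z /mmax zm; apply: (le_trans zm); apply/ler_addgt0Pr => e e0.
have e20 : 0 < e / 2 by rewrite divr_gt0.
have [N] := ltr_add_invr e20; rewrite add0r => Ne.
have [k Nk /rV_ballP[_ /(_ i)]] := yl _ N e20.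
have [_ _] := Hy k.
have re : k.+1%:R^-1 < e / 2.
  by apply: le_lt_trans Ne; rewrite lef_pV2 ?posrE// ler_nat.
rewrite ltr_distl; move: k.+1%:R^-1 re => u re ? /andP[? ?]; lra.
Qed.


(* [G w] is the set of lexicographic maximizers of the coordinates in [s]; a
   symmetric set with lexicographic maximum 0 is reduced to 0. *)
Lemma lexicographic_maximizers (s : seq 'I_n) S : (forall w, compact (S w)) ->
  (forall w, S w !=set0) -> closed_measurable S ->
  exists G, [/\ forall w, G w !=set0, forall w, G w `<=` S w,
    closed_measurable G,
    forall w i x y, i \in s -> G w x -> G w y -> x ord0 i = y ord0 i &
    forall w, (forall x, S w x -> S w (- x)) -> G w 0 ->
      forall i x, i \in s -> S w x -> x ord0 i = 0].
Proof.
elim: s S => [|i s IH] S cS S0 mS.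
  by exists S; split=> [//|w x //|//|w i x y|w _ _ i x]; rewrite in_nil.
pose S' w := coord_maximizers i (S w).
have S'S w : S' w `<=` S w by move=> x; case.
have cS' w : compact (S' w) by exact: compact_coord_maximizers.
have S'0 w : S' w !=set0 by exact: coord_maximizers_nonempty.
have mS' : closed_measurable S' by exact: closed_measurable_coord_maximizers.
have [G [G0 GS' mG Gs Gsym]] := IH S' cS' S'0 mS'.
exists G; split => //.
- by move=> w; exact: subset_trans (GS' w) (S'S w).
- move=> w j x y; rewrite in_cons => /orP[/eqP ->|]; last exact: Gs.
  move=> /GS'[Sx xmax] /GS'[Sy ymax].
  by apply/eqP; rewrite eq_le xmax// ymax.
- move=> w Ssym Gw0.
  have Si x : S w x -> x ord0 i = 0.
    have [_ max0] := GS' _ _ Gw0.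
    move=> Sx; apply/eqP; rewrite eq_le.
    have := max0 _ Sx; have := max0 _ (Ssym _ Sx).
    by rewrite !mxE oppr_le0 => -> ->.
  move=> j x; rewrite in_cons => /orP[/eqP ->|js Sx]; first exact: Si.
  (* Once coordinate [i] vanishes on [S w], all its points are maximizers; [S' w] is then [S w],
     still symmetric, and the induction hypothesis applies. *)
  have S'E y : S w y -> S' w y.
    by move=> Sy; split=> // z Sz; rewrite !Si.
  apply: (Gsym w _ Gw0 j x js (S'E _ Sx)) => y /S'S Sy.
  exact/S'E/Ssym.
Qed.

(** Maximizing every coordinate in turn leaves a single point, so [closed_measurable G] becomes the
    measurability of [f]. By symmetry this point is 0 only if [S w] has no other element. *)
Lemma symmetric_selection S : (forall w, compact (S w)) ->
  (forall w, S w !=set0) -> closed_measurable S ->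
  (forall w x, S w x -> S w (- x)) ->
  exists f, [/\ Borel_measurable f, forall w, S w (f w) &
    forall w x, f w = 0 -> S w x -> x = 0].
Proof.
move=> cS S0 mS Ssym.
have [G [G0 GS mG G1 Gsym]] := lexicographic_maximizers (enum 'I_n) cS S0 mS.
have /choice[f Gf] := G0.
exists f; split.
- apply: (@measurability _ _ Omega (g_sigma_algebraType (@open V)) setT f
  (@open V)) => // _ [B oB <-].
  rewrite setTI -[B]setCK preimage_setC; apply: measurableC.
  have := mG _ (open_closedC oB).
  congr measurable; apply/seteqP; split=> w /=; last by exists (f w).
  move=> [x [Gx Bx]]; suff <- : x = f w by [].
  by apply/rowP => i; apply: G1 (Gf w); rewrite ?mem_enum.
- by move=> w; exact/GS.
- move=> w x fw0 Sx; apply/rowP => i; rewrite mxE.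
  apply: (Gsym w) => //; [exact: Ssym|by rewrite -fw0|by rewrite mem_enum].
Qed.

(** * Extreme points and symmetric segments *)

Lemma convex_set_combination (A : set V) x y t : convex_set A -> A x -> A y ->
  0 <= t -> t <= 1 -> A (t *: x + (1 - t) *: y).
Proof.
move=> cA Ax Ay t0 t1.
by have := cA x y (Itv01 t0 t1) (mem_set Ax) (mem_set Ay); rewrite inE.
Qed.

(** If x = t y + (1 - t) z, the shorter part of the segment, laid off on both sides of x, stays in
    [A]: the direction is t (y - z) for t <= 1/2 and (1 - t) (y - z) otherwise. *)
Lemma not_extreme_direction (A : set V) x : convex_set A -> A x ->
  (forall v, A (x + v) -> A (x - v) -> v = 0) -> extreme_points A x.
Proof.
move=> cA Ax Av; split=> // y z t Ay Az t0 t1 xE.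
suff yz : y = z.
  by move: xE; rewrite yz -scalerDl addrC subrK scale1r => ->.
have [t2|t2] := leP t 2^-1.
  have : t *: (y - z) = 0.
    apply: Av.
      rewrite (_ : x + _ = (t *+ 2) *: y + (1 - t *+ 2) *: z).
        by apply: convex_set_combination => //; lra.
      by rewrite xE; apply/rowP => i; rewrite !mxE; ring.
    rewrite (_ : x - _ = z)//.
    by rewrite xE; apply/rowP => i; rewrite !mxE; ring.
  by move/eqP; rewrite scaler_eq0 gt_eqF//= subr_eq0 => /eqP.
have : (1 - t) *: (y - z) = 0.
  apply: Av.
    rewrite (_ : x + _ = y)//.
    by rewrite xE; apply/rowP => i; rewrite !mxE; ring.
  rewrite (_ : x - _ = (1 - (1 - t) *+ 2) *: y + (1 - (1 - (1 - t) *+ 2)) *: z).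
    by apply: convex_set_combination => //; lra.
  by rewrite xE; apply/rowP => i; rewrite !mxE; ring.
by move/eqP; rewrite scaler_eq0 gt_eqF ?subr_gt0//= subr_eq0 => /eqP.
Qed.

Lemma nonextreme_direction S h : (forall w, compact (S w)) ->
  (forall w, convex_set (S w)) ->
  measurable_set_valued S -> Borel_measurable h -> (forall w, S w (h w)) ->
  exists f, [/\ Borel_measurable f,
    forall w, S w (h w + f w) /\ S w (h w - f w) &
    forall w, f w = 0 -> extreme_points (S w) (h w)].
Proof.
move=> cS convS mS mh Sh.
pose G w := [set x | S w (h w + x) /\ S w (h w - x)].
have cG w : compact (G w).
  have clS := compact_closed (@norm_hausdorff _ V) (cS w).
  apply: (subclosed_compact (B := (fun x => x - h w) @` S w)).
  - move=> x clx; split; apply: closed_approx clS _ => e e0;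
      have [z [[Gz Gz'] /rV_ballP[_ xz]]] := clx _ (nbhsx_ballx x e e0).
      exists (h w + z) => //; apply/rV_ballP; split=> // i.
      by have := xz i; rewrite !mxE !ltr_distl; lra.
    exists (h w - z) => //; apply/rV_ballP; split=> // i.
    by have := xz i; rewrite !mxE !ltr_distl; lra.
  - apply: continuous_compact (cS w); apply: continuous_subspaceT => x.
    by apply: continuousB => //; exact: cst_continuous.
  - by move=> x [Sx _]; exists (h w + x) => //; rewrite addrC addKr.
have G0 w : G w !=set0 by exists 0; rewrite /G /= addr0 subr0.
have Gsym w x : G w x -> G w (- x) by move=> [? ?]; split; rewrite ?opprK.
have [f [mf Gf f0]] := symmetric_selection cG G0
  (closed_measurable_symmetric cS mS mh) Gsym.
exists f; split=> // w fw0.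
by apply: not_extreme_direction => // v Sv Sv'; exact: f0 fw0 _.
Qed.

(** A point of [A] farthest from the origin in the Euclidean norm is extreme, by strict convexity of
    the squared norm. Such points will serve as values on the final null set. *)
Lemma extreme_point_exists (A : set V) : compact A -> A !=set0 ->
  extreme_points A !=set0.
Proof.
move=> cA A0.
pose q (x : V) : R := \sum_(i < n) x ord0 i ^+ 2.
have cq : continuous q.
  apply: continuous_big => [|i _]; first exact: add_continuous.
  move=> x; apply: (@continuous_comp _ _ _ (fun x : V => x ord0 i) (fun y : R => y ^+ 2)).
    exact: coord_continuous.
  exact: exprn_continuous.
have [x xA xmax] := EVT_max_rV A0 cA (continuous_subspaceT cq).
exists x; split=> [|y z t Ay Az t0 t1 xE]; first exact/set_mem.
suff yz : y = z.
  by move: xE; rewrite yz -scalerDl addrC subrK scale1r => ->.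
have qx : q x = t * q y + (1 - t) * q z - t * (1 - t) * q (y - z).
  rewrite /q !mulr_sumr -big_split/= -sumrB; apply: eq_bigr => i _.
  by rewrite xE !mxE; ring.
have q_ge0 v : 0 <= q v by apply: sumr_ge0 => i _; exact: sqr_ge0.
have qyz : q (y - z) = 0.
  apply/eqP; rewrite eq_le q_ge0 andbT.
  rewrite -(pmulr_rle0 _ (mulr_gt0 t0 (_ : 0 < 1 - t))) ?subr_gt0//.
  have := xmax _ (mem_set Ay); have := xmax _ (mem_set Az).
  nra.
apply/rowP => i; apply/eqP; rewrite -subr_eq0.
move/eqP : qyz; rewrite psumr_eq0 => [|j _]; last exact: sqr_ge0.
by move=> /allP/(_ i); rewrite mem_index_enum sqrf_eq0 !mxE; apply.
Qed.

End measurable_selection.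

(** * The weighted L2 distance *)

Lemma geometric_increments_cvg (R : realType) (u : nat -> R) (a : R) :
  (forall k, `|u k.+1 - u k| <= a * 2 ^- k) -> cvgn u.
Proof.
move=> ua.
have -> : u = (fun n => u 0%N + series (telescope u) n).
  by apply/funext => n; exact: eq_sum_telescope.
apply: is_cvgD; first exact: is_cvg_cst.
apply: normed_cvg; apply: (@series_le_cvg _ _ (geometric a 2^-1)).
- by move=> n; exact: normr_ge0.
- move=> n /=; rewrite exprVn; exact: le_trans (ua n).
- by move=> n /=; rewrite exprVn; exact: ua.
- by apply: is_cvg_geometric_series; rewrite ger0_norm ?invf_lt1//; lra.
Qed.

(** The sum of the [b k] has integral at most 2, hence is finite a.e., and it bounds each of its
    terms. *)
Lemma ae_bounded_of_summable_integrals d (T : measurableType d) (R : realType)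
    (mu : {measure set T -> \bar R}) (b : nat -> T -> R) :
  (forall k, measurable_fun [set: T] (b k)) -> (forall k x, 0 <= b k x) ->
  (forall k, \int[mu]_x (b k x)%:E <= (2 ^- k)%:E)%E ->
  {ae mu, forall x, exists B, forall k, b k x <= B}.
Proof.
move=> mb b0 ib.
pose g x := (\sum_(k <oo) (b k x)%:E)%E.
have b0' k x : [set: T] x -> (0 <= (b k x)%:E)%E by rewrite lee_fin.
have mb' k : measurable_fun [set: T] (fun x => (b k x)%:E) by exact/measurable_EFinP.
have ig : mu.-integrable [set: T] g.
  apply/integrableP; split.
    by apply: ge0_emeasurable_sum => // k x _ _; rewrite lee_fin.
  apply: (@le_lt_trans _ _ 2%:E); last exact: ltry.
  rewrite (eq_integral g); last first.
    by move=> x _; rewrite gee0_abs//; apply: nneseries_ge0 => k _ _; rewrite lee_fin.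
  rewrite integral_nneseries//.
  have := @cvg_geometric_eseries_half R 2 0.
  rewrite expr0 divr1 => /cvg_lim <-//.
  apply: lee_nneseries => [k _ _|k _].
    by apply: integral_ge0 => x _; rewrite lee_fin.
  apply: (le_trans (ib k)); rewrite lee_fin addn1 natrX exprS invfM mulrA mulfV ?mul1r//.
have := integrable_ae measurableT ig.
apply: filterS => x /(_ Logic.I) gx.
exists (fine (g x)) => k; rewrite -lee_fin fineK//.
apply: (@le_trans _ _ (\sum_(0 <= j < k.+1) (b j x)%:E)%E).
  by rewrite big_nat_recr//= leeDr// sume_ge0// => j _; rewrite lee_fin.
by apply: nneseries_lim_ge => j _ _; rewrite lee_fin.
Qed.

Section weighted_distance.
Context {d : measure_display} {Omega : measurableType d} {R : realType}.
Context {n : nat}.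
Variables (mu : probability Omega R) (phi : Omega -> R).
Hypothesis mphi : measurable_fun [set: Omega] phi.
Hypothesis phi_ge0 : forall w, 0 <= phi w.
Notation V := 'rV[R]_n.
Notation Borel_measurable f := (measurable_fun [set: Omega]
  (f : Omega -> g_sigma_algebraType (@open V))).
Implicit Types (x y z : Omega -> V).

Definition dominated x :=
  (forall i, measurable_fun [set: Omega] (fun w => x w ord0 i)) /\
  forall w i, `|x w ord0 i| <= phi w.

Definition wsq x y w : R :=
  \sum_(i < n) ((x w ord0 i - y w ord0 i) / (1 + phi w)) ^+ 2.

(** A squared distance despite the name, without a root, so that the parallelogram identity holds
    exactly. *)
Definition wdist x y : R := \int[mu]_w wsq x y w.

Let den_gt0 w : 0 < 1 + phi w. Proof. by rewrite ltr_pwDl. Qed.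

Let mden : measurable_fun [set: Omega] (fun w => (1 + phi w)^-1).
Proof. by apply: measurable_funV_gt0 => //; exact: measurable_funD. Qed.

Lemma dominated_quotient x y w i : dominated x -> dominated y ->
  `|(x w ord0 i - y w ord0 i) / (1 + phi w)| <= 2.
Proof.
move=> [_ xphi] [_ yphi].
rewrite normrM normfV (gtr0_norm (den_gt0 w)) ler_pdivrMr//.
have := xphi w i; have := yphi w i; rewrite !ler_norml => /andP[? ?] /andP[? ?].
have := phi_ge0 w; lra.
Qed.

Lemma measurable_quotient x y i : dominated x -> dominated y ->
  measurable_fun [set: Omega] (fun w => (x w ord0 i - y w ord0 i) / (1 + phi w)).
Proof.
by move=> [mx _] [my _]; apply: measurable_funM => //; exact: measurable_funB.
Qed.

Lemma wsq_ge0 x y w : 0 <= wsq x y w.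
Proof. by apply: sumr_ge0 => i _; exact: sqr_ge0. Qed.

Lemma wsq_le x y w : dominated x -> dominated y -> wsq x y w <= 4 *+ n.
Proof.
move=> dx dy; apply: (@le_trans _ _ (\sum_(i < n) 4)); last first.
  by rewrite sumr_const card_ord.
apply: ler_sum => i _; have := dominated_quotient w i dx dy.
by rewrite ler_norml => /andP[? ?]; nra.
Qed.

Lemma measurable_wsq x y : dominated x -> dominated y ->
  measurable_fun [set: Omega] (wsq x y).
Proof.
move=> dx dy; apply: measurable_sum => i.
by apply: measurable_funX; exact: measurable_quotient.
Qed.

Lemma integrable_of_bound (u : Omega -> R) (M : R) : measurable_fun [set: Omega] u ->
  (forall w, `|u w| <= M) -> mu.-integrable [set: Omega] (EFin \o u).
Proof.
move=> mu' uM.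
apply: (@le_integrable _ _ _ mu setT measurableT _ (cst M%:E)).
- exact/measurable_EFinP.
- by move=> w _ /=; rewrite lee_fin (le_trans (uM w))// ler_norm.
- exact: finite_measure_integrable_cst.
Qed.

Lemma integrable_wsq x y : dominated x -> dominated y ->
  mu.-integrable [set: Omega] (EFin \o wsq x y).
Proof.
move=> dx dy; apply: (@integrable_of_bound _ (4 *+ n)); first exact: measurable_wsq.
by move=> w; rewrite ger0_norm ?wsq_ge0// wsq_le.
Qed.

Lemma wdist_bounds x y : dominated x -> dominated y -> 0 <= wdist x y <= 4 *+ n.
Proof.
move=> dx dy; apply/andP; split; first by apply: Rintegral_ge0 => w _; exact: wsq_ge0.
have -> : 4 *+ n = \int[mu]_(w in [set: Omega]) (4 *+ n) :> R.
  by rewrite Rintegral_cst// [X in fine X](probability_setT mu) mulr1.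
apply: le_Rintegral => //; first exact: integrable_wsq.
  exact: finite_measure_integrable_cst.
by move=> w _; exact: wsq_le.
Qed.

Lemma wdist_refl x : wdist x x = 0.
Proof.
rewrite /wdist (@eq_Rintegral _ _ _ mu setT (cst 0)).
  by rewrite Rintegral_cst// mul0r.
by move=> w _; rewrite /wsq big1// => i _; rewrite subrr mul0r expr0n.
Qed.

(** This is the midpoint premise of [quadratic_variational_principle], the real [g] there being
    [wdist g (fun=> 0)]. *)
Lemma wdist_parallelogram h g y : dominated (fun w => h w + g w) ->
  dominated (fun w => h w - g w) -> dominated h -> dominated y -> dominated g ->
  wdist (fun w => h w + g w) y + wdist (fun w => h w - g w) y =
  wdist h y *+ 2 + wdist g (fun=> 0) *+ 2.
Proof.
move=> dp dm dh dy dg.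
have d0 : dominated (fun=> 0 : V).
  by split=> [i|w i]; rewrite mxE ?normr0//.
have ihy := integrable_wsq dh dy; have ig0 := integrable_wsq dg d0.
have ihy2 : mu.-integrable [set: Omega] (EFin \o (fun w => wsq h y w + wsq h y w)).
  by have := integrableD measurableT ihy ihy.
have ig02 : mu.-integrable [set: Omega]
    (EFin \o (fun w => wsq g (fun=> 0) w + wsq g (fun=> 0) w)).
  by have := integrableD measurableT ig0 ig0.
rewrite !mulr2n /wdist -!RintegralD//; [|exact: integrable_wsq..].
apply: eq_Rintegral => w _.
by rewrite /wsq -!big_split/=; apply: eq_bigr => i _; rewrite !mxE; ring.
Qed.

Definition wgap x y w : R := \sum_(i < n) `|(x w ord0 i - y w ord0 i) / (1 + phi w)|.

Lemma wgap_le x y w : dominated x -> dominated y -> wgap x y w <= 2 *+ n.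
Proof.
move=> dx dy; apply: (@le_trans _ _ (\sum_(i < n) 2)); last first.
  by rewrite sumr_const card_ord.
by apply: ler_sum => i _; exact: dominated_quotient.
Qed.

Lemma wgap_ge0 x y w : 0 <= wgap x y w.
Proof. exact: sumr_ge0. Qed.

Lemma measurable_wgap x y : dominated x -> dominated y ->
  measurable_fun [set: Omega] (wgap x y).
Proof.
move=> dx dy; apply: measurable_sum => i.
by apply: measurableT_comp => //; exact: measurable_quotient.
Qed.

Lemma integrable_wgap x y : dominated x -> dominated y ->
  mu.-integrable [set: Omega] (EFin \o wgap x y).
Proof.
move=> dx dy; apply: (@integrable_of_bound _ (2 *+ n)); first exact: measurable_wgap.
by move=> w; rewrite ger0_norm ?wgap_ge0// wgap_le.
Qed.

(** a^2 - b^2 = (a - b)(a + b) with weighted coordinates a, b bounded by 2, whence the 4. The bound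
    is free of [y], which gives the uniformity in [wdist_cvg]. *)
Lemma wdist_lipschitz x x' y : dominated x -> dominated x' -> dominated y ->
  `|wdist x y - wdist x' y| <= 4 * \int[mu]_w wgap x x' w.
Proof.
move=> dx dx' dy.
have ixy := integrable_wsq dx dy; have ix'y := integrable_wsq dx' dy.
have ig := integrable_wgap dx dx'.
have iD : mu.-integrable [set: Omega] (EFin \o (fun w => wsq x y w - wsq x' y w)).
  by have := integrableB measurableT ixy ix'y.
rewrite /wdist -RintegralB// -RintegralZl//.
apply: (le_trans (le_normr_Rintegral _ _)) => //.
apply: le_Rintegral => //.
- exact: integrable_norm iD.
- by have := integrableZl measurableT 4 ig.
move=> w _; rewrite /wsq -sumrB mulr_sumr (le_trans (ler_norm_sum _ _ _))//.
apply: ler_sum => i _.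
have := dominated_quotient w i dx dy; have := dominated_quotient w i dx' dy.
rewrite (_ : (x w ord0 i - x' w ord0 i) / _ =
  (x w ord0 i - y w ord0 i) / (1 + phi w) -
  (x' w ord0 i - y w ord0 i) / (1 + phi w)); last by ring.
set a := _ / _; set b := _ / _ => b2 a2.
rewrite subr_sqr normrM mulrC ler_wpM2r// (le_trans (ler_normD _ _))//.
lra.
Qed.

Lemma wdist_cvg (z : nat -> Omega -> V) l : (forall k, dominated (z k)) ->
  dominated l ->
  {ae mu, forall w i, z ^~ w ^~ ord0 ^~ i @ \oo --> l w ord0 i} ->
  forall e, 0 < e -> exists N, forall k, (N <= k)%N ->
    forall y, dominated y -> `|wdist (z k) y - wdist l y| <= e.
Proof.
move=> dz dl zl e e0.
have [] := @dominated_convergence _ _ _ mu setT measurableT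
  (fun k => EFin \o wgap (z k) l) (cst 0%E) (cst (2 *+ n)%:E).
- by move=> k; apply/measurable_EFinP; exact: measurable_wgap.
- exact: measurable_cst.
- apply: filterS zl => w zlw _; apply/cvg_EFin; first by apply: nearW.
  have -> : 0 = \sum_(i < n) 0 :> R by rewrite big1.
  apply: cvg_big => [|i _]; first exact: add_continuous.
  rewrite -[0](@normr0 _ R); apply: cvg_norm.
  rewrite -(mul0r (1 + phi w)^-1); apply: cvgMr_tmp.
  by rewrite -(subrr (l w ord0 i)); apply: cvgB; [exact: zlw|exact: cvg_cst].
- exact: finite_measure_integrable_cst.
- by apply/aeW => w k _ /=; rewrite lee_fin ger0_norm ?wgap_ge0// wgap_le.
move=> _ _; rewrite integral0 => h.
have [N _ HN] : \forall k \near \oo, \int[mu]_w wgap (z k) l w < e / 4.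
  have e4 : 0 < e / 4 by rewrite divr_gt0.
  exact: (cvgr_lt _ (fine_cvg h) _ e4).
exists N => k Nk y dy; apply: le_trans (wdist_lipschitz (dz k) dl dy) _.
by have := HN k Nk; rewrite /=; lra.
Qed.

(** Fast Cauchy sequences converge a.e.: [16 ^- k] is split into [2 ^- k], which makes the integrals
    of the [b k] summable, and [8 ^- k], which leaves a.e. increments of geometric size. *)
Lemma wdist_complete (S : Omega -> set V) (z : nat -> Omega -> V) :
  (forall w, closed (S w)) ->
  (forall w (v : V) i, S w v -> `|v ord0 i| <= phi w) ->
  (forall k, Borel_measurable (z k)) -> (forall k w, S w (z k w)) ->
  (forall k, wdist (z k.+1) (z k) <= 16 ^- k) ->
  exists l, [/\ Borel_measurable l, forall w, S w (l w) &
    {ae mu, forall w i, z ^~ w ^~ ord0 ^~ i @ \oo --> l w ord0 i}].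
Proof.
move=> cS Sphi mz Sz z_fast.
have dz k : dominated (z k).
  by split=> [i|w i]; [move/Borel_measurableP : (mz k); exact|exact: Sphi].
pose b k w := 8 ^+ k * wsq (z k.+1) (z k) w.
have mb k : measurable_fun [set: Omega] (b k).
  by apply: measurable_funM => //; exact: measurable_wsq.
have b0 k w : 0 <= b k w by rewrite mulr_ge0 ?exprn_ge0// wsq_ge0.
have ib k : (\int[mu]_w (b k w)%:E <= (2 ^- k)%:E)%E.
  have iw := integrable_wsq (dz k.+1) (dz k).
  have ibk : mu.-integrable [set: Omega] (EFin \o b k).
    by have := integrableZl measurableT (8 ^+ k) iw.
  rewrite -(fineK (integrable_fin_num measurableT ibk)) lee_fin.
  rewrite -/(Rintegral mu setT (b k)) RintegralZl//.
  have -> : 2 ^- k = 8 ^+ k * 16 ^- k :> R.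
    rewrite (_ : 16 = 8 * 2 :> R); last by rewrite -natrM.
    by rewrite exprMn invfM mulrA mulfV ?mul1r// expf_neq0// pnatr_eq0.
  by rewrite ler_pM2l ?exprn_gt0//; exact: z_fast.
have [N [mN N0 bN]] := ae_bounded_of_summable_integrals mb b0 ib.
have z_cvg w i : ~ N w -> cvgn (z ^~ w ^~ ord0 ^~ i).
  move=> Nw; have [B wB] : exists B, forall k, b k w <= B.
    by apply: contrapT => ?; apply: Nw; exact: bN.
  have B0 : 0 <= B := le_trans (b0 0%N w) (wB 0%N).
  (* [1 + phi w] undoes the weight, and [1 + B] avoids a square root: [B * 8 ^- k] is at most the
     square of [(1 + B) * 2 ^- k]. *)
  apply: (@geometric_increments_cvg _ _ ((1 + phi w) * (1 + B))) => k.
  have : `|(z k.+1 w ord0 i - z k w ord0 i) / (1 + phi w)| <= (1 + B) * 2 ^- k.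
    have u0 : 0 < (2 : R) ^- k by rewrite invr_gt0 exprn_gt0.
    have u1 : (2 : R) ^- k <= 1.
      by rewrite invf_le1 ?exprn_gt0// exprn_ege1//; lra.
    have := wB k; rewrite /b -ler_pdivlMl ?exprn_gt0//.
    have -> : (8 : R) ^- k = (2 ^- k) ^+ 3.
      rewrite -!exprVn -exprM mulnC exprM; congr (_ ^+ k).
      by rewrite exprVn -natrX.
    move: (2 ^- k) u0 u1 => u u0 u1 wle.
    rewrite -ler_sqr ?nnegrE ?normr_ge0//; last by apply: mulr_ge0; lra.
    rewrite real_normK ?num_real//; apply: (@le_trans _ _ (u ^+ 3 * B)).
      apply: le_trans wle; rewrite /wsq (bigD1 i)//= lerDl.
      by apply: sumr_ge0 => j _; exact: sqr_ge0.
    rewrite (_ : u ^+ 3 * B = u ^+ 2 * (u * B)); last by ring.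
    rewrite (_ : ((1 + B) * u) ^+ 2 = u ^+ 2 * (1 + B) ^+ 2); last by ring.
    by rewrite ler_wpM2l ?sqr_ge0//; nra.
  rewrite normrM normfV (gtr0_norm (den_gt0 w)) ler_pdivrMr//.
  by rewrite mulrC mulrA.
(* On the exceptional set, [z 0] keeps [l] a selection at every point. *)
pose l w := if w \in N then z 0%N w else \row_i limn (z ^~ w ^~ ord0 ^~ i).
have lN w : ~ N w -> forall i, z ^~ w ^~ ord0 ^~ i @ \oo --> l w ord0 i.
  by move=> Nw i; rewrite /l memNset// mxE; exact: z_cvg.
exists l; split.
- apply/Borel_measurableP => i.
  pose z' k w := if w \in N then z 0%N w ord0 i else z k w ord0 i.
  apply: (@measurable_fun_cvg _ _ _ _ z').
    move=> k; apply: measurable_fun_ifT => //.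
      apply: (measurable_fun_bool true); rewrite setTI.
      rewrite (_ : _ @^-1` _ = N)//.
      by apply/seteqP; split=> x /=; [move/set_mem|move/mem_set].
    exact: (dz _).1.
    exact: (dz _).1.
  move=> w _; rewrite /z'; case: (boolP (w \in N)) => wN.
    by rewrite /l wN; exact: cvg_cst.
  by apply: lN => /mem_set; exact/negP.
- move=> w; have [Nw|Nw] := pselect (N w).
    by rewrite /l mem_set.
  apply: closed_approx (cS w) _ => e e0.
  have /choice[K HK] (i : 'I_n) : exists K, forall k, (K <= k)%N ->
      `|l w ord0 i - z k w ord0 i| < e.
    by have /cvgrPdist_lt/(_ e e0)[K _ HK] := lN w Nw i; exists K.
  exists (z (\max_i K i) w) => //; apply/rV_ballP; split=> // i.
  by apply: HK; exact: leq_bigmax.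
- exists N; split=> // w /= lw; apply: contrapT => Nw; apply: lw => i; exact: lN.
Qed.

End weighted_distance.

(** * Extreme selections *)

Lemma norm2_coord (R : realType) (n : nat) (x : 'rV[R]_n) i : `|x ord0 i| <= norm2 x.
Proof.
rewrite -sqrtr_sqr ler_wsqrtr// (bigD1 i)//= lerDl.
by apply: sumr_ge0 => j _; exact: sqr_ge0.
Qed.

Section extreme_selection.
Context {d : measure_display} {Omega : measurableType d} {R : realType}.
Variables (mu : probability Omega R) (C : set (set Omega)).
Hypothesis C_sigma_algebra : sigma_algebra [set: Omega] C.
Hypothesis C_sub : C `<=` measurable.
Notation integrable u := (mu.-integrable [set: Omega] (EFin \o u)).

(** Puts the limit given by [wdist_complete] back among the selections with the prescribed
    conditional expectation. *)
Lemma cond_null_dominated_cvg (u_ : nat -> Omega -> R) (u b : Omega -> R) :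
  (forall k, cond_null mu C (u_ k)) -> measurable_fun [set: Omega] u ->
  {ae mu, forall w, u_ ^~ w @ \oo --> u w} -> integrable b ->
  (forall k w, `|u_ k w| <= b w) -> cond_null mu C u.
Proof.
move=> u0 mu' u_u ib ub.
have mu_ k : measurable_fun [set: Omega] (u_ k).
  by apply/measurable_EFinP; exact: measurable_int (u0 k).1.
have dct A : measurable A -> [/\ mu.-integrable A (EFin \o u),
    [sequence \int[mu]_(x in A) `|(u_ n x)%:E - (u x)%:E|]_n @ \oo --> 0 &
    [sequence \int[mu]_(x in A) (u_ n x)%:E]_n @ \oo --> \int[mu]_(x in A) (u x)%:E]%E.
  move=> mA; apply: (@dominated_convergence _ _ _ mu A mA (fun k => EFin \o u_ k)
    (EFin \o u) (EFin \o b)).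
  - by move=> k; apply/measurable_funTS/measurable_EFinP.
  - by apply/measurable_funTS/measurable_EFinP.
  - apply: filterS u_u => w uw _; apply/cvg_EFin; first by apply: nearW.
    exact: uw.
  - exact: integrableS ib.
  - by apply/aeW => w k _ /=; rewrite lee_fin.
split; first by have [] := dct _ measurableT.
move=> A CA; have [_ _] := dct _ (C_sub CA).
under [X in X @ _ --> _ -> _]eq_fun do rewrite (proj2 (u0 _) _ CA).
by move=> /(cvg_lim (@ereal_hausdorff R)) <-; exact: lim_cst.
Qed.

Hypothesis coarser : mu_coarser mu C.
Context {n : nat}.
Notation V := 'rV[R]_n.
Variable T : Omega -> set V.
Hypothesis T_measurable : measurable_set_valued T.
Hypothesis T_compact : forall w, compact (T w).
Hypothesis T_convex : forall w, convex_set (T w).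
Variable phi : Omega -> R.
Hypothesis iphi : integrable phi.
Hypothesis T_phi : forall w (v : V) i, T w v -> `|v ord0 i| <= phi w.
Hypothesis phi_ge0 : forall w, 0 <= phi w.

Lemma selection_dominated (f : Omega -> V) : measurable_selections T f -> dominated phi f.
Proof.
by move=> [/Borel_measurableP mf Tf]; split=> // w i; exact: T_phi.
Qed.

Let mphi : measurable_fun [set: Omega] phi.
Proof. by apply/measurable_EFinP; exact: measurable_int iphi. Qed.

Lemma dominated_integrable (f : Omega -> V) i : dominated phi f ->
  integrable (fun w => f w ord0 i).
Proof.
move=> [mf fphi]; apply: (le_integrable measurableT _ _ iphi).
  exact/measurable_EFinP.
by move=> w _ /=; rewrite lee_fin (le_trans (fphi w i))// ler_norm.
Qed.

Definition equivalent_selections (f : Omega -> V) : set (Omega -> V) :=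
  [set z | measurable_selections T z /\
    forall i, cond_null mu C (fun w => z w ord0 i - f w ord0 i)].

Lemma wdist_extreme_selection f : measurable_selections T f ->
  exists2 h, equivalent_selections f h &
    forall x x' g, equivalent_selections f x -> equivalent_selections f x' ->
      (forall y, equivalent_selections f y ->
         wdist mu phi x y + wdist mu phi x' y = wdist mu phi h y *+ 2 + g *+ 2) ->
      g <= 0.
Proof.
move=> Tf.
have dom z : equivalent_selections f z -> dominated phi z.
  by move=> [+ _]; exact: selection_dominated.
apply: (@quadratic_variational_principle _ _ _ _ (4 *+ n) f).
- by split=> // i; under eq_fun do rewrite subrr; exact: cond_null0.
- by move=> x y /dom dx /dom dy; exact: wdist_bounds.
- by move=> x _; exact: wdist_refl.
move=> z Kz z_fast.
have clT w : closed (T w) by exact: (compact_closed (@norm_hausdorff _ V) (@T_compact w)).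
have [l [ml Tl zl]] := wdist_complete mphi phi_ge0 clT T_phi
  (fun k => (Kz k).1.1) (fun k => (Kz k).1.2) z_fast.
have Tsl : measurable_selections T l by [].
exists l.
  split=> // i.
  apply: (@cond_null_dominated_cvg (fun k w => z k w ord0 i - f w ord0 i) _
    (fun w => phi w + phi w)).
  - by move=> k; exact: (Kz k).2.
  - apply: measurable_funB; [exact: (selection_dominated Tsl).1|].
    exact: (selection_dominated Tf).1.
  - apply: filterS zl => w zlw; apply: cvgB; first exact: zlw.
    exact: cvg_cst.
  - by have := integrableD measurableT iphi iphi.
  - move=> k w; rewrite (le_trans (ler_normB _ _))// lerD//.
      exact: (dom _ (Kz k)).2.
    exact: (selection_dominated Tf).2.
move=> e e0.
have [N HN] := wdist_cvg mphi phi_ge0 (fun k => dom _ (Kz k))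
  (selection_dominated Tsl) zl e0.
by exists N => k Nk y /dom; exact: HN.
Qed.

Lemma extreme_equivalent_selection f : measurable_selections T f ->
  exists2 h, equivalent_selections f h &
    {ae mu, forall w, extreme_points (T w) (h w)}.
Proof.
move=> Tf; have [h Kh h_max] := wdist_extreme_selection Tf.
have [[mh Th] h_null] := Kh.
have [g [mg Tg g0]] := nonextreme_direction T_compact T_convex T_measurable mh Th.
have /Borel_measurableP mg' := mg.
have dg : dominated phi g.
  split=> // w i; have [/(T_phi i) + /(T_phi i)] := Tg w.
  rewrite !mxE !ler_norml => /andP[? ?] /andP[? ?]; lra.
pose q w := \sum_(i < n) g w ord0 i ^+ 2.
have q_eq0 w : (q w == 0) = (g w == 0).
  rewrite /q psumr_eq0 => [|i _]; last exact: sqr_ge0.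
  apply/allP/eqP => [g_0|->]; last by move=> i _; rewrite /= mxE expr0n eqxx.
  apply/rowP => i; rewrite mxE; apply/eqP.
  by have := g_0 i (mem_index_enum i); rewrite sqrf_eq0.
have mq : measurable_fun [set: Omega] q.
  by apply: measurable_sum => i; exact: measurable_funX.
have mE : measurable [set w | q w != 0] by exact: measurable_neq0.
have [E0|E_neq0] := pselect (mu [set w | q w != 0] = 0%E).
  exists h => //; exists [set w | q w != 0]; split=> // w /= next.
  apply/eqP => /eqP; rewrite q_eq0 => /eqP /g0; exact: next.
exfalso; move/measure_gt0P : E_neq0 => E_gt0.
(* The list of all coordinates of [g], so that the same multiplier annihilates each of them. *)
pose s := [seq (fun w => g w ord0 i) | i <- enum 'I_n].
have is_ v : v \in s -> integrable v.
  by move=> /mapP[i _ ->]; exact: dominated_integrable.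
have [eps [meps eps_le1 eps_E eps_neq0 eps_null]] :=
  coarser_annihilator C_sigma_algebra C_sub coarser is_ mE E_gt0.
pose p w := eps w *: g w.
have p_null i : cond_null mu C (fun w => p w ord0 i).
  have := eps_null (fun w => g w ord0 i) (map_f _ (mem_enum _ i)).
  congr cond_null; apply/funext => w /=; by rewrite mxE.
have mp i : measurable_fun [set: Omega] (fun w => p w ord0 i).
  rewrite /p; under eq_fun do rewrite mxE; exact: measurable_funM.
have Tp (t : R) w : `|t| <= 1 -> T w (h w + t *: g w).
  rewrite ler_norml => /andP[t1 t2]; have [T1 T2] := Tg w.
  rewrite (_ : h w + _ = ((1 + t) / 2) *: (h w + g w) + (1 - (1 + t) / 2) *: (h w - g w)).
    by apply: convex_set_combination => //; lra.
  by apply/rowP => i; rewrite !mxE; field.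
have Kp (c : R) : `|c| <= 1 -> equivalent_selections f (fun w => h w + c *: p w).
  move=> c1; have hp w i : (h w + c *: p w) ord0 i = h w ord0 i + c * p w ord0 i.
    by rewrite !mxE.
  split; first split.
  - apply/Borel_measurableP => i; under eq_fun do rewrite hp.
    apply: measurable_funD; first by move/Borel_measurableP : mh; exact.
    by apply: measurable_funM => //; exact: mp.
  - move=> w; rewrite /p scalerA; apply: Tp.
    by rewrite normrM mulr_ile1.
  - move=> i; rewrite (_ : (fun _ => _) =
        (fun w => h w ord0 i - f w ord0 i) \+ (fun w => c * p w ord0 i)).
      by apply: (cond_nullD C_sub) => //; exact: (cond_nullZ C_sub).
    by apply/funext => w /=; rewrite hp; ring.
have Kp1 : equivalent_selections f (fun w => h w + p w).
  have := Kp 1; rewrite normr1 => /(_ (lexx _)).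
  by under eq_fun do rewrite scale1r.
have Km1 : equivalent_selections f (fun w => h w - p w).
  have := Kp (-1); rewrite normrN1 => /(_ (lexx _)).
  by under eq_fun do rewrite scaleN1r.
have dom z : equivalent_selections f z -> dominated phi z.
  by move=> [+ _]; exact: selection_dominated.
have dp : dominated phi p.
  split=> // w i; rewrite mxE normrM -[phi w]mul1r.
  by apply: ler_pM => //; exact: dg.2.
(* Maximality gives [wdist p 0 <= 0], hence [p = 0] a.e.; but [eps], and with it [p], is nonzero on
   a set of positive measure inside the set where [g] is nonzero. *)
have := h_max _ _ (wdist mu phi p (fun=> 0)) Kp1 Km1.
apply/not_implyP; split.
  move=> y /dom dy; apply: wdist_parallelogram => //; exact: dom.
move=> dp0.
have d0 : dominated phi (fun=> 0 : V).
  by split=> [i|w i]; rewrite mxE ?normr0.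
have ip := integrable_wsq mu mphi phi_ge0 dp d0.
have : (\int[mu]_w `|(EFin \o wsq phi p (fun=> 0%R)) w| = 0)%E.
  rewrite (eq_integral (fun w => (wsq phi p (fun=> 0%R) w)%:E)); last first.
    by move=> w _; rewrite gee0_abs// lee_fin wsq_ge0.
  rewrite -(fineK (integrable_fin_num measurableT ip)); congr EFin.
  apply/eqP; rewrite eq_le dp0 /=.
  by have /andP[] := wdist_bounds mu mphi phi_ge0 dp d0.
move=> /(ae_eq_integral_abs mu measurableT (measurable_int _ ip)) [N [mN N0 pN]].
move/measure_gt0P : eps_neq0; apply.
apply: (subset_measure0 _ mN _ N0); first exact: measurable_neq0.
move=> w /= epsw; apply: pN => /= /(_ Logic.I) /eqP; rewrite eqe.
rewrite /wsq psumr_eq0 => [|i _]; last exact: sqr_ge0.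
move=> /allP p0; have : p w = 0.
  apply/rowP => i; rewrite [RHS]mxE; apply/eqP.
  have := p0 i (mem_index_enum i); rewrite [X in _ - X]mxE subr0 sqrf_eq0 mulf_eq0.
  have den0 : 0 < 1 + phi w by rewrite ltr_pwDl.
  by rewrite invr_eq0 (gt_eqF den0) orbF.
move/eqP; rewrite scaler_eq0 (negbTE epsw)/= -q_eq0 => qw0.
move: epsw; rewrite eps_E ?eqxx//= qw0; exact/negP.
Qed.

End extreme_selection.

Theorem theorem3 (R : realType) (d : measure_display)
  (Omega : measurableType d) (mu : probability Omega R)
  (n : nat) (T : Omega -> set 'rV[R]_n) (C : set (set Omega))
  (mu_complete : measure_is_complete mu)
  (T_measurable : measurable_set_valued T)
  (T_bounded : L1_bounded mu T)
  (T_compact : forall w, compact (T w))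
  (T_convex : forall w, convex_set (T w))
  (T_nonempty : forall w, T w !=set0)
  (C_sigma_algebra : sigma_algebra [set: Omega] C)
  (C_sub : C `<=` measurable)
  (C_coarser : mu_coarser mu C) :
  cond_exp mu C @` measurable_selections T =
  cond_exp mu C @` measurable_selections (fun w => extreme_points (T w)).
Proof.
apply/seteqP; split; last first.
  by move=> _ [g [mg ext_g] <-]; exists g => //; split=> // w; case: (ext_g w).
move=> _ [f Tf <-].
have [phi [iphi T_phi]] := T_bounded.
have T_phi' w (v : 'rV[R]_n) i : T w v -> `|v ord0 i| <= phi w.
  by move=> Tv; rewrite (le_trans (norm2_coord v i))// T_phi.
have phi_ge0 w : 0 <= phi w.
  by have [v /T_phi] := T_nonempty w; apply: le_trans; exact: sqrtr_ge0.
have [h [[mh Th] h_null] [N [mN N0 ext_h]]] := extreme_equivalent_selection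
  C_sigma_algebra C_sub C_coarser T_measurable T_compact T_convex iphi T_phi' phi_ge0 Tf.
(* This choice has no measurability; it is used only on [N], all of whose subsets are measurable by
   completeness. *)
have /choice[e ext_e] w : exists e, extreme_points (T w) e.
  exact: extreme_point_exists (T_compact w) (T_nonempty w).
pose g w := if w \in N then e w else h w.
have ext_g w : extreme_points (T w) (g w).
  rewrite /g; case: (boolP (w \in N)) => // /negP wN.
  by apply: contrapT => ext_hw; apply: wN; apply/mem_set/ext_h.
have mg : measurable_fun [set: Omega]
    (g : Omega -> g_sigma_algebraType (@open 'rV[R]_n)).
  move=> _ B mB; rewrite setTI.
  rewrite (_ : g @^-1` B = (h @^-1` B `\` N) `|` (g @^-1` B `&` N)).
    apply: measurableU.
      by apply: measurableD => //; rewrite -[X in measurable X]setTI; exact: mh.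
    by apply: mu_complete; exists N; split=> // w [].
  apply/seteqP; split=> w.
    have [Nw|Nw] := pselect (N w); first by right.
    by move=> gB; left; split=> //; move: gB; rewrite /= /g memNset.
  by move=> [[hB Nw]|[]//]; rewrite /= /g memNset.
have Tg : measurable_selections T g by split=> // w; case: (ext_g w).
have dom z : measurable_selections T z -> dominated phi z.
  exact: selection_dominated T_phi' _.
have gf_null i : cond_null mu C (fun w => g w ord0 i - f w ord0 i).
  rewrite (_ : (fun _ => _) = (fun w => g w ord0 i - h w ord0 i) \+
      (fun w => h w ord0 i - f w ord0 i)); last by apply/funext => w /=; ring.
  apply: (cond_nullD C_sub) => //.
  have igh : mu.-integrable [set: Omega] (EFin \o (fun w => g w ord0 i - h w ord0 i)).
    have := integrableB measurableT (dominated_integrable iphi i (dom _ Tg))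
      (dominated_integrable iphi i (dom h _)).
    by apply; split.
  apply: (cond_null_ae0 C_sub igh); apply: (subset_measure0 _ mN _ N0).
    by apply: measurable_neq0; apply/measurable_EFinP; exact: measurable_int igh.
  move=> w /=; rewrite /g; case: (boolP (w \in N)) => [/set_mem//|_].
  by rewrite subrr eqxx.
exists g => //.
have gf_int i A : C A ->
    (\int[mu]_(w in A) (g w ord0 i)%:E = \int[mu]_(w in A) (f w ord0 i)%:E)%E.
  move=> CA; apply: (cond_null_integral C_sub _ _ (gf_null i) CA).
    exact: (dominated_integrable iphi i (dom _ Tg)).
  exact: (dominated_integrable iphi i (dom _ Tf)).
(* [is_cond_exp] sees its first argument only through integrals over members of [C], so equal
   integrals give the same set of versions. *)
by apply/seteqP; split=> c cE i; have [mc ic c_int] := cE i; split=> // A CA;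
  rewrite c_int// gf_int.
Qed.
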